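(* Let $\nu>0$, let $N\ge1$ be an integer, let $f\in L^\infty(\mathbb T)$, and let $u$ be the unique solution on $\mathbb T$ of $$u-\nu^2\partial_{xx}u=\Pi_Nf.$$ The following hold. (i) (Strict maximum principle) If $N\ge\frac{1}{2\pi^2\nu}e^{\frac1{2\nu}}$, then $\|u\|_{L^\infty(\mathbb T)}\le\|f\|_{L^\infty(\mathbb T)}$. (ii) (Generalized maximum principle) For all $N\ge1$, $$\|u\|_{L^\infty(\mathbb T)}\le\Bigl(1+\frac{\alpha_1}{1+(\pi\nu N)^2}\log(N+2)\Bigr)\|f\|_{L^\infty(\mathbb T)},$$ where $\alpha_1>0$ is an absolute constant. (iii) (Lower bound) For each $N\ge1$ there exists a smooth $f^{(N)}$ with $\|f^{(N)}\|_{L^\infty(\mathbb T)}=1$ such that the corresponding solution $u^{(N)}$ satisfies $$\|u^{(N)}\|_{L^\infty(\mathbb T)}\ge\frac{\alpha_2}{1+(\pi N\nu)^2}\log(N+2)-1,$$ where $\alpha_2>0$ is an absolute constant. (iv) (Lower bound for small $\nu$) Assume $0<\nu\ll1$. For each $N$ satisfying $\frac{1}{2\sqrt3\,\pi\nu}\le N\lesssim\frac{1}{\sqrt\nu}e^{\frac1{6\nu}}$ there exists a smooth $f^{(N)}$ with $\|f^{(N)}\|_{L^\infty(\mathbb T)}=1$ such that the corresponding solution $u^{(N)}$ satisfies $$\|u^{(N)}\|_{L^\infty(\mathbb T)}\ge1+\frac{\alpha_3}{1+4\pi^2\nu^2(N+1)^2},$$ where $\alpha_3>0$ is an absolute consta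nt.
   Context: $\mathbb T=\mathbb R/\mathbb Z$, identified with $[0,1)$; $\Pi_Nf(x)=\sum_{|k|\le N}\widehat f(k)e^{2\pi ikx}$ with $\widehat f(k)=\int_0^1f(x)e^{-2\pi ikx}dx$. $X\lesssim Y$ means $X\le CY$ for some absolute constant $C>0$ whose precise value is unimportant; $0<\nu\ll1$ means $\nu\le c$ for a sufficiently small absolute constant $c>0$. *)

(* Defs.v *)
From HB Require Import structures.
From mathcomp Require Import all_boot all_order all_algebra.
From mathcomp Require Import all_classical all_reals all_analysis.
From mathcomp Require Import complex.

Set Implicit Arguments.
Unset Strict Implicit.
Unset Printing Implicit Defensive.

Import Order.TTheory GRing.Theory Num.Theory.
Import numFieldNormedType.Exports.
Import ComplexField.Normc.

Local Open Scope classical_set_scope.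
Local Open Scope ring_scope.
Local Open Scope complex_scope.

(* Functions on the torus R/Z are 1-periodic functions on R; integrals and
   essential suprema are taken over the fundamental domain [0, 1). *)

Definition torus_measure (R : realType) :
    {measure set (measurableTypeR R) -> \bar R} :=
  mrestr (@lebesgue_measure R) (measurable_itv `[0 : R, 1 : R[).

Definition Linfty_norm (R : realType) (f : R -> R[i]) : \bar R :=
  Lnorm (torus_measure R) +oo%E (fun x => (normc (f x))%:E).

(* Membership is stated for representatives. A measurable representative is a
   Borel one: every class modulo null sets contains such a function. *)
Definition in_Linfty (R : realType) (f : R -> R[i]) : Prop :=
  [/\ periodic f 1,
      measurable_fun [set: R] (fun x => complex.Re (f x)),
      measurable_fun [set: R] (fun x => complex.Im (f x))
    & (Linfty_norm f < +oo)%E].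

(* e^{2 pi i k x} *)
Definition echar (R : realType) (k : int) (x : R) : R[i] :=
  cos (2 * pi * k%:~R * x) +i* sin (2 * pi * k%:~R * x).

Definition fourier_coef (R : realType) (f : R -> R[i]) (k : int) : R[i] :=
  (\int[torus_measure R]_x complex.Re (f x * echar (- k) x))
  +i* (\int[torus_measure R]_x complex.Im (f x * echar (- k) x)).

(* The index j < 2N + 1 stands for the frequency k = j - N, so |k| <= N. *)
Definition fourier_proj (R : realType) (N : nat) (f : R -> R[i]) (x : R) :
    R[i] :=
  \sum_(j < N.*2.+1)
    fourier_coef f (j%:Z - N%:Z) * echar (j%:Z - N%:Z) x.

Definition derivable_upto (R : realType) (n : nat) (g : R -> R) : Prop :=
  forall (k : nat) (x : R), (k < n)%N -> derivable (derive1n k g) x 1.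

Definition smooth (R : realType) (g : R -> R) : Prop :=
  forall n : nat, derivable_upto n g.

Definition dxx (R : realType) (u : R -> R[i]) (x : R) : R[i] :=
  derive1n 2 (fun y => complex.Re (u y)) x
  +i* derive1n 2 (fun y => complex.Im (u y)) x.

Definition is_solution (R : realType) (nu : R) (N : nat) (f u : R -> R[i]) :
    Prop :=
  [/\ periodic u 1,
      derivable_upto 2 (fun x => complex.Re (u x)),
      derivable_upto 2 (fun x => complex.Im (u x))
    & forall x, u x - (nu ^+ 2)%:C * dxx u x = fourier_proj N f x].

Definition to_complex (R : realType) (g : R -> R) : R -> R[i] :=
  fun x => (g x)%:C.

(* Main.v *)
Require Import Defs.
From HB Require Import structures.
From mathcomp Require Import all_boot all_order all_algebra.
From mathcomp Require Import all_classical all_reals all_analysis.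
From mathcomp Require Import complex.
From mathcomp Require Import measurable_realfun ess_sup_inf ring lra zify.

(* The solution is u = K_N * f, where K_N has Fourier coefficients
   a_k = 1 / (1 + (2 pi nu k)^2) for |k| <= N, so everything is about the L^1
   norm of K_N. Let G be the full periodic Green function (an explicit cosh) and
   let b_k = a_k (1 - k / (M + 1)) be the coefficients of the Fejér mean
   sigma_M = G * F_M; since F_M >= 0 has mean one, sigma_M lies between the
   local extrema of G up to o(1), and M is sent to infinity in the end.
   (i) K_N differs from sigma_M by a tail of size 1 / (2 pi^2 nu^2 N), which is
   at most min G, so K_N >= 0 and its L^1 norm is 1.
   (ii) If a is convex beyond N, subtracting from sigma_M the positive kernel
   whose coefficients extend b linearly below N leaves K_N up to b_N D_N and a
   multiple of the Fejér kernel of small mass; otherwise a_N is bounded below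
   and Abel summation gives |K_N| <= sup_k |D_k|. The Dirichlet kernel is
   dominated pointwise by 5 (F_1 / 1 + ... + F_N / N), of mass O(log N).
   (iii) Fejér's polynomial sum_j (cos 2 pi (N - j) x - cos 2 pi (N + j) x) / j
   is bounded, and its truncation at N is large at 0.
   (iv) Near x = 1/2 the function G is exponentially small, while two Abel
   summations show that K_N - G is a_{N+1} sin((2 N + 1) pi x) / sin(pi x) up to
   lower order. Flipping the sign of f = 1 according to this oscillation on a
   fixed window gains a multiple of a_{N+1}. A Fejér mean of this f is smooth. *)

Set Implicit Arguments.
Unset Strict Implicit.
Unset Printing Implicit Defensive.

Import Order.TTheory GRing.Theory Num.Theory.
Import numFieldNormedType.Exports.

Local Open Scope classical_set_scope.
Local Open Scope ring_scope.

(** * Cosine polynomials; Fejér and Dirichlet kernels *)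

Section CosinePolynomials.
Variable R : realType.
Implicit Types (x y : R) (s t : nat -> R) (k n m : nat).

(** Kernels are finite cosine sums throughout, and no L^1 norm is computed. An upper bound on a
    kernel is a pointwise majorant by another cosine polynomial, whose integral is its coefficient
    at 0; a lower bound pairs the kernel with a test polynomial, which evaluates a solution at 0.
    The Green function G enters only through bounds on its Fejér means, obtained from the mean value
    theorem and the explicit cosh. The obstacle is that 1 / (1 + xi^2) is concave near 0. Convexity,
    which gives positivity through Fejér kernels, is available only once 3 (2 pi nu N)^2 >= 1. This
    is the lower limit on N in (iv) and the case distinction in (ii). In (iv), put e = exp(1 / (12
    nu)). On [5/12, 7/12] the function G is at most a multiple of e^-5 / nu, while N <= C nu^(-1/2)
    e^2 keeps a_{N+1} above a multiple of e^-4 / (C^2 nu). The spare factor e beats all constants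
    once nu is small in terms of C. *)

Definition cosk k x : R := cos (2 * pi * k%:R * x).

Definition sink k x : R := sin (2 * pi * k%:R * x).

(* [t k] is the Fourier coefficient at both frequencies [k] and [- k]. *)
Definition cospoly n t x : R := t 0%N + 2 * \sum_(k < n) t k.+1 * cosk k.+1 x.

Lemma cosk0 x : cosk 0 x = 1.
Proof. by rewrite /cosk mulr0 mul0r cos0. Qed.

Lemma cosk_x0 k : cosk k 0 = 1.
Proof. by rewrite /cosk mulr0 cos0. Qed.

Lemma coskSS k x : cosk k.+2 x = 2 * cosk 1 x * cosk k.+1 x - cosk k x.
Proof.
rewrite /cosk; set a := 2 * pi * 1%:R * x; set b := 2 * pi * k.+1%:R * x.
have -> : 2 * pi * k.+2%:R * x = b + a by rewrite /a /b -(natr1 k.+1); ring.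
have -> : 2 * pi * k%:R * x = b - a by rewrite /a /b -(natr1 k); ring.
by rewrite cosD cosB; ring.
Qed.

Lemma cosk_le1 k x : cosk k x <= 1. Proof. exact: cos_le1. Qed.

Lemma norm_cosk k x : `|cosk k x| <= 1. Proof. exact: cos_max. Qed.

Lemma coskN k x : cosk k (- x) = cosk k x.
Proof. by rewrite /cosk mulrN cosN. Qed.

Lemma cosk_sin k x : cosk k x = 1 - 2 * sin (k%:R * (pi * x)) ^+ 2.
Proof.
rewrite /cosk.
have -> : 2 * pi * k%:R * x = (k%:R * (pi * x)) *+ 2 by rewrite mulr2n; ring.
by rewrite cos_mulr2n cos2sin2; ring.
Qed.

Lemma cospoly0 t x : cospoly 0 t x = t 0%N.
Proof. by rewrite /cospoly big_ord0 mulr0 addr0. Qed.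

Lemma cospolyS n t x :
  cospoly n.+1 t x = cospoly n t x + 2 * (t n.+1 * cosk n.+1 x).
Proof. by rewrite /cospoly big_ord_recr /= mulrDr addrA. Qed.

Lemma eq_cospoly n s t x :
  (forall k, (k <= n)%N -> s k = t k) -> cospoly n s x = cospoly n t x.
Proof.
move=> st; rewrite /cospoly st//; congr (_ + 2 * _).
by apply: eq_bigr => i _; rewrite st.
Qed.

Lemma cospolyD n s t x :
  cospoly n (fun k => s k + t k) x = cospoly n s x + cospoly n t x.
Proof.
by elim: n => [|n IH]; rewrite ?cospoly0// !cospolyS IH; ring.
Qed.

Lemma cospolyZ n a t x :
  cospoly n (fun k => a * t k) x = a * cospoly n t x.
Proof.
by elim: n => [|n IH]; rewrite ?cospoly0// !cospolyS IH; ring.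
Qed.

Lemma cospoly_sum n m (t : nat -> nat -> R) x :
  cospoly n (fun k => \sum_(i < m) t i k) x = \sum_(i < m) cospoly n (t i) x.
Proof.
elim: m => [|m IH]; last first.
  rewrite big_ord_recr /= -IH -cospolyD; apply: eq_cospoly => k _.
  by rewrite big_ord_recr.
rewrite big_ord0; under eq_cospoly do rewrite big_ord0.
by elim: n => [|n IH]; rewrite ?cospoly0// cospolyS IH; ring.
Qed.

Lemma cospoly_widen n m t x : (n <= m)%N ->
  (forall k, (n < k)%N -> t k = 0) -> cospoly m t x = cospoly n t x.
Proof.
move=> nm t0; elim: m nm => [|m IH]; first by rewrite leqn0 => /eqP ->.
rewrite leq_eqVlt => /predU1P[->//|nm].
by rewrite cospolyS t0 ?(leq_trans nm)// IH//; ring.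
Qed.

Lemma cospoly_le_sum n t x :
  `|cospoly n t x| <= `|t 0%N| + 2 * \sum_(k < n) `|t k.+1|.
Proof.
rewrite (le_trans (ler_normD _ _))// lerD2l normrM ger0_norm//.
rewrite ler_pM2l// (le_trans (ler_norm_sum _ _ _))// ler_sum// => i _.
by rewrite normrM ler_piMr// norm_cosk.
Qed.

(** Two summations by parts, kept multiplied out so that integer x is allowed. The quotients (1 -
    cos 2 pi m x) / (1 - cos 2 pi x) are m times Fejér kernels. *)
Lemma cospoly_second_diff n t x :
  2 * (1 - cosk 1 x) * cospoly n t x =
  2 * \sum_(k < n) (t k - 2 * t k.+1 + t k.+2) * (1 - cosk k.+1 x)
  + 2 * t n * (1 - cosk n.+1 x) - 2 * t n.+1 * (1 - cosk n x).
Proof.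
elim: n => [|n IH]; first by rewrite cospoly0 big_ord0 cosk0; ring.
rewrite cospolyS mulrDr IH big_ord_recr /= coskSS; ring.
Qed.

(** Convexity makes the polynomial a nonnegative combination of Fejér kernels; [t n.+1 = 0] removes
    the only negative boundary term. *)
Lemma cospoly_convex_ge0 n t x :
  (forall k, (k <= n)%N -> 0 <= t k) -> t n.+1 = 0 ->
  (forall k, (k < n)%N -> 0 <= t k - 2 * t k.+1 + t k.+2) ->
  0 <= cospoly n t x.
Proof.
(* If [cosk 1 x = 1] the summed identity reads 0 = 0, but then every cosine equals 1 and the claim
   is a sum of nonnegative terms. *)
move=> t0 tn tc; have := cosk_le1 1 x; rewrite le_eqVlt => /predU1P[c1|c1].
  have ck k : cosk k x = 1.
    suff : cosk k x = 1 /\ cosk k.+1 x = 1 by case.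
    elim: k => [|k [IH1 IH2]]; first by rewrite cosk0.
    by rewrite coskSS c1 IH1 IH2; split=> //; ring.
  rewrite /cospoly addr_ge0 ?t0// mulr_ge0// sumr_ge0// => i _.
  by rewrite ck mulr1 t0.
have c2 : 0 < 2 * (1 - cosk 1 x) by rewrite mulr_gt0// subr_gt0.
rewrite -(pmulr_rge0 _ c2) cospoly_second_diff tn mulr0 mul0r subr0.
rewrite addr_ge0// ?mulr_ge0 ?t0 ?subr_ge0 ?cosk_le1// sumr_ge0// => i _.
by rewrite mulr_ge0 ?tc// subr_ge0 cosk_le1.
Qed.

(** The weights max(0, 1 - k / n): truncated subtraction supplies the positive part, so [fejer n.+1]
    lives on k <= n. *)
Definition fejer n k : R := (n - k)%N%:R / n%:R.

Lemma fejer0 n : (0 < n)%N -> fejer n 0 = 1.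
Proof. by move=> n0; rewrite /fejer subn0 divff// pnatr_eq0 -lt0n. Qed.

Lemma fejer_ge0 n k : 0 <= fejer n k.
Proof. by rewrite /fejer divr_ge0. Qed.

Lemma fejer_big n k : (n <= k)%N -> fejer n k = 0.
Proof. by rewrite /fejer -subn_eq0 => /eqP ->; rewrite mul0r. Qed.

Lemma fejerE n k : (0 < n)%N -> (k <= n)%N -> fejer n k = 1 - k%:R / n%:R.
Proof.
move=> n0 kn; rewrite /fejer natrB// mulrBl divff// pnatr_eq0 -lt0n//.
Qed.

Lemma fejer_convex n k : 0 <= fejer n k - 2 * fejer n k.+1 + fejer n k.+2.
Proof.
rewrite /fejer; set i := n%:R^-1.
have i0 : 0 <= i by rewrite invr_ge0.
have -> : (n - k)%:R * i - 2 * ((n - k.+1)%:R * i) + (n - k.+2)%:R * i =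
  i * ((n - k)%:R + (n - k.+2)%:R - 2 * (n - k.+1)%:R) by ring.
by rewrite mulr_ge0// subr_ge0 -natrM -natrD ler_nat; lia.
Qed.

Lemma fejer_kernel_ge0 n x : 0 <= cospoly n (fejer n.+1) x.
Proof.
apply: cospoly_convex_ge0 => [k _||k _].
- exact: fejer_ge0.
- exact: fejer_big.
- exact: fejer_convex.
Qed.

(** The weights are affine up to [n.+1], so all second differences vanish and only one boundary term
    is left. *)
Lemma fejer_kernelE n x : (n.+1%:R * sin (pi * x) ^+ 2) * cospoly n (fejer n.+1) x
  = sin (n.+1%:R * (pi * x)) ^+ 2.
Proof.
have h : 2 * (1 - cosk 1 x) = 4 * sin (pi * x) ^+ 2.
  by rewrite cosk_sin mul1r; ring.
have := cospoly_second_diff n (fejer n.+1) x.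
rewrite h big1 => [|[k kn] _ /=]; last first.
  rewrite !fejerE//; try lia.
  by rewrite -(natr1 k.+1) -(natr1 k); field; rewrite addrC natr1 pnatr_eq0.
rewrite mulr0 add0r (fejer_big (leqnn n.+1)) mulr0 mul0r subr0 (cosk_sin n.+1).
rewrite /fejer subSn// subnn => e.
have n0 : n.+1%:R != 0 :> R by rewrite pnatr_eq0.
have -> : sin (n.+1%:R * (pi * x)) ^+ 2 = n.+1%:R / 4 *
  (2 * (1 / n.+1%:R) * (1 - (1 - 2 * sin (n.+1%:R * (pi * x)) ^+ 2))).
  by field.
by rewrite -e; field.
Qed.

Lemma dirichlet_kernelE n x :
  cospoly n (fun=> 1) x * sin (pi * x) = sin ((2 * n + 1)%:R * (pi * x)).
Proof.
elim: n => [|n IH]; first by rewrite cospoly0 !mul1r.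
rewrite cospolyS mulrDl IH mul1r /cosk.
set a := pi * x; set b := 2 * pi * n.+1%:R * x.
have -> : (2 * n.+1 + 1)%:R * a = b + a.
  by rewrite /a /b natrD natrM; ring.
have -> : (2 * n + 1)%:R * a = b - a.
  by rewrite /a /b natrD natrM -(natr1 n); ring.
by rewrite sinB sinD; ring.
Qed.

Lemma norm_sin_natM k (y : R) : `|sin (k%:R * y)| <= k%:R * `|sin y|.
Proof.
elim: k => [|k IH]; first by rewrite !mul0r sin0 normr0.
rewrite -natr1 mulrDl mul1r sinD (le_trans (ler_normD _ _))// mulrDl mul1r.
rewrite lerD// normrM.
  by rewrite (le_trans _ IH)// ler_piMr// cos_max.
by rewrite ler_piMl// cos_max.
Qed.

Lemma cosk_lower k x : 1 - 2 * k%:R ^+ 2 * sin (pi * x) ^+ 2 <= cosk k x.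
Proof.
rewrite cosk_sin lerD2l lerN2 -mulrA ler_pM2l// -exprMn.
rewrite -[_ ^+ 2]real_normK ?num_real// -[leRHS]real_normK ?num_real//.
by rewrite ler_pXn2r ?nnegrE// normrM normr_nat norm_sin_natM.
Qed.

(** Each cosine is replaced by its quadratic lower bound and the power sums are evaluated. As long
    as (n + 1) |sin pi x| <= 1, the kernel keeps two thirds of its peak value n + 1. *)
Lemma fejer_kernel_lower n x :
  n.+1%:R * (1 - n.+1%:R ^+ 2 * sin (pi * x) ^+ 2 / 3)
    <= cospoly n (fejer n.+1) x.
Proof.
set s := sin (pi * x) ^+ 2.
have s0 : 0 <= s by exact: sqr_ge0.
have n0 : n.+1%:R != 0 :> R by rewrite pnatr_eq0.
apply: (@le_trans _ _
  (1 + 2 * \sum_(k < n) fejer n.+1 k.+1 * (1 - 2 * k.+1%:R ^+ 2 * s))); last first.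
  rewrite /cospoly fejer0// lerD2l ler_pM2l// ler_sum// => k _.
  by rewrite ler_wpM2l ?fejer_ge0// cosk_lower.
have S1 m : \sum_(k < m) (k.+1%:R : R) = m%:R * (m%:R + 1) / 2.
  elim: m => [|m IH]; first by rewrite big_ord0 !mul0r.
  by rewrite big_ord_recr /= IH -natr1; field.
have S2 m : \sum_(k < m) (k.+1%:R ^+ 2 : R) =
    m%:R * (m%:R + 1) * (2 * m%:R + 1) / 6.
  elim: m => [|m IH]; first by rewrite big_ord0 !mul0r.
  by rewrite big_ord_recr /= IH -natr1; field.
have S3 m : \sum_(k < m) (k.+1%:R ^+ 3 : R) =
    m%:R ^+ 2 * (m%:R + 1) ^+ 2 / 4.
  elim: m => [|m IH]; first by rewrite big_ord0 expr0n !mul0r.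
  by rewrite big_ord_recr /= IH -natr1; field.
set I := (n.+1%:R)^-1 : R.
rewrite (_ : \sum_(k < n) _ = \sum_(k < n) 1 - I * (\sum_(k < n) k.+1%:R)
   - 2 * s * \sum_(k < n) k.+1%:R ^+ 2
   + 2 * s * I * \sum_(k < n) k.+1%:R ^+ 3); last first.
  rewrite !mulr_sumr -sumrB -sumrB -big_split /=; apply: eq_bigr => k _.
  by rewrite fejerE// ?ltnS// /I 1?ltnW//; ring.
rewrite S1 S2 S3 sumr_const card_ord /I -natr1.
have n1 : n%:R + 1 != 0 :> R by rewrite natr1.
set N := n%:R : R in n1 *.
have N0 : 0 <= N by rewrite /N.
rewrite -subr_ge0 (_ : _ - _ = s * (N + 1) / 3); last by field.
by rewrite divr_ge0// mulr_ge0// addr_ge0.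
Qed.

(* Coefficients of [5 (F_1 / 1 + ... + F_n / n)], [F_i] the Fejér kernel. *)
Definition dirichlet_major n k : R :=
  5 * \sum_(i < n) fejer i.+1 k / i.+1%:R.

Lemma dirichlet_majorE n m x : (n <= m)%N ->
  cospoly m (dirichlet_major n) x =
  5 * \sum_(i < n) cospoly i (fejer i.+1) x / i.+1%:R.
Proof.
move=> nm; rewrite (cospolyZ m 5 (fun k => \sum_(i < n) fejer i.+1 k / i.+1%:R)).
rewrite (cospoly_sum m n (fun i k => fejer i.+1 k / i.+1%:R)).
congr (5 * _); apply: eq_bigr => i _.
rewrite mulrC -cospolyZ; under eq_cospoly do rewrite mulrC.
apply: cospoly_widen => [|k ik]; last by rewrite fejer_big// mulr0.
by rewrite (leq_trans _ nm)// ltnW.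
Qed.

Lemma dirichlet_major0 n :
  dirichlet_major n 0 = 5 * \sum_(i < n) i.+1%:R^-1.
Proof.
by congr (5 * _); apply: eq_bigr => i _; rewrite fejer0// mul1r.
Qed.

(** With s = |sin pi x|, the Dirichlet kernel is at most min(2n + 1, 1/s). Each quotient F_i / i
    with i s <= 1 is at least 2/3, and there are m = min(n, floor(1/s)) of them. The factor 5 makes
    this 10 m / 3, which covers both 2n + 1 <= 3n and 1/s < m + 1 <= 2m. *)
Lemma dirichlet_major_bound n x : (0 < n)%N ->
  `|cospoly n (fun=> 1) x| <= cospoly n (dirichlet_major n) x.
Proof.
move=> n0; rewrite dirichlet_majorE//.
set s := `|sin (pi * x)|.
have s0 : 0 <= s by rewrite /s.
have s1 : s <= 1 by rewrite /s sin_max.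
have key m : (m <= n)%N -> m%:R * s <= 1 ->
    2 / 3 * m%:R <= \sum_(i < n) cospoly i (fejer i.+1) x / i.+1%:R.
  move=> mn ms; rewrite -(big_mkord xpredT (fun i => cospoly i (fejer i.+1) x / i.+1%:R)).
  rewrite (big_cat_nat (leq0n m) mn)//= ler_wpDr ?sumr_ge0//.
    by move=> i _; rewrite divr_ge0// fejer_kernel_ge0.
  rewrite big_mkord (_ : 2 / 3 * m%:R = \sum_(i < m) (2 / 3)); last first.
    by rewrite sumr_const card_ord mulr_natr.
  apply: ler_sum => i _; rewrite ler_pdivlMr// mulrC.
  apply: le_trans (fejer_kernel_lower i x); rewrite ler_pM2l//.
  rewrite -(real_normK (num_real (sin _))) -/s -exprMn.
  suff : (i.+1%:R * s) ^+ 2 <= 1 by lra.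
  rewrite expr_le1 ?mulr_ge0// (le_trans _ ms)// ler_wpM2r// ler_nat.
  exact: ltn_ord.
have [ns|ns] := leP (n%:R * s) 1.
  apply: (@le_trans _ _ (2 * n%:R + 1)).
    apply: le_trans (cospoly_le_sum _ _ _) _.
    by under eq_bigr do rewrite normr1; rewrite sumr_const card_ord normr1 addrC.
  have := key n (leqnn n) ns; have : 1 <= n%:R :> R by rewrite ler1n.
  set S := \sum_(i < n) _; lra.
have sp : 0 < s.
  by rewrite lt_neqAle s0 andbT eq_sym; apply/eqP => s00; move: ns; rewrite s00 mulr0 ltr10.
have [m ms] : exists m, m = Num.truncn s^-1 by eexists.
have /andP[m1 m2] : m%:R <= s^-1 < m.+1%:R by rewrite ms truncn_itv// invr_ge0.
have ms1 : m%:R * s <= 1 by rewrite -ler_pdivlMr// div1r.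
have mn : (m <= n)%N.
  by rewrite -(ler_nat R) (le_trans m1)// -div1r ler_pdivrMr// ltW.
apply: (@le_trans _ _ s^-1).
  rewrite -div1r ler_pdivlMr// -normrM dirichlet_kernelE; exact: sin_max.
have := key m mn ms1.
have s1' : 1 <= s^-1 by rewrite invf_ge1.
have m0 : 1 <= m%:R :> R.
  by rewrite ler1n lt0n; apply/eqP => m00; move: m2; rewrite m00; lra.
set S := \sum_(i < n) _; rewrite -natr1 in m2; lra.
Qed.

Lemma dirichlet_major_le m n x : (m <= n)%N ->
  cospoly m (dirichlet_major m) x <= cospoly n (dirichlet_major n) x.
Proof.
move=> mn; rewrite !dirichlet_majorE// ler_pM2l//.
rewrite -!(big_mkord xpredT (fun i => cospoly i (fejer i.+1) x / i.+1%:R)).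
rewrite (big_cat_nat (leq0n m) mn)//= ler_wpDr ?sumr_ge0// => i _.
by rewrite divr_ge0// fejer_kernel_ge0.
Qed.

Lemma cospoly_abel n t x :
  cospoly n t x = \sum_(k < n) (t k - t k.+1) * cospoly k (fun=> 1) x
     + t n * cospoly n (fun=> 1) x.
Proof.
elim: n => [|n IH]; first by rewrite big_ord0 !cospoly0; ring.
by rewrite big_ord_recr /= !cospolyS IH; ring.
Qed.

Lemma cospoly_decr_bound n t x : (0 < n)%N ->
  (forall k, 0 <= t k) -> (forall k, t k.+1 <= t k) ->
  `|cospoly n t x| <= t 0%N * cospoly n (dirichlet_major n) x.
Proof.
move=> n0 t0 td; set D := cospoly n (dirichlet_major n) x.
have h k : (k <= n)%N -> `|cospoly k (fun=> 1) x| <= D.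
  (* The kernel D_0 = 1 needs its own argument: the first term 5 F_1 of the majorant is already the
     constant 5. *)
  case: k => [_|k kn].
    rewrite (@le_trans _ _ (cospoly 1 (dirichlet_major 1) x))//; last first.
      exact: dirichlet_major_le.
    rewrite dirichlet_majorE// cospoly0 normr1 big_ord_recr big_ord0 /=.
    by rewrite cospoly0 fejer0//; lra.
  exact: le_trans (dirichlet_major_bound _ _) (dirichlet_major_le _ kn).
have -> : t 0%N * D = \sum_(k < n) (t k - t k.+1) * D + t n * D.
  rewrite -mulr_suml -mulrDl; congr (_ * _).
  elim: n {D h n0} => [|n IH]; first by rewrite big_ord0 add0r.
  by rewrite big_ord_recr /= IH; ring.
rewrite cospoly_abel (le_trans (ler_normD _ _))// lerD//; last first.
  by rewrite normrM ger0_norm// ler_wpM2l// h.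
rewrite (le_trans (ler_norm_sum _ _ _))// ler_sum// => k _.
rewrite normrM ger0_norm ?subr_ge0// ler_wpM2l ?subr_ge0// h//.
by rewrite ltnW.
Qed.

End CosinePolynomials.

(** * Differentiation rules and the mean value theorem *)

Section RealDerivatives.
Variable R : realType.
Implicit Types (f g : R -> R) (a b x : R).

Lemma is_derive_add f g a b x : is_derive x 1 f a -> is_derive x 1 g b ->
  is_derive x 1 (fun y => f y + g y) (a + b).
Proof. by move=> df dg; exact: is_deriveD. Qed.

Lemma is_derive_mul f g a b x : is_derive x 1 f a -> is_derive x 1 g b ->
  is_derive x 1 (fun y => f y * g y) (a * g x + f x * b).
Proof.
move=> df dg; apply: (is_derive_eq (is_deriveM df dg)).
by rewrite /GRing.scale/= addrC mulrC.
Qed.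

Lemma is_derive_mulcl f a c x : is_derive x 1 f a ->
  is_derive x 1 (fun y => c * f y) (c * a).
Proof. by move=> df; exact: (@is_deriveZ _ _ _ f c x 1 a). Qed.

Lemma is_derive_opp f a x : is_derive x 1 f a ->
  is_derive x 1 (fun y => - f y) (- a).
Proof. by move=> df; exact: is_deriveN. Qed.

Lemma is_derive_affine a b x : is_derive x 1 (fun y => a * y + b) a.
Proof.
apply: (is_derive_eq (is_derive_add (is_derive_mulcl a (is_derive_id x 1))
  (is_derive_cst b x 1))).
by rewrite mulr1 addr0.
Qed.

(** The chain rule is used only through affine maps written [a * y + b], which is why arguments
    further on are padded with [1 *] and [+ 0]. *)
Lemma is_derive_comp_affine f c a b x : is_derive (a * x + b) 1 f c ->
  is_derive x 1 (fun y => f (a * y + b)) (a * c).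
Proof.
move=> df; have da := is_derive_affine a b x.
rewrite mulrC; exact: (@is_derive1_comp _ f (fun y => a * y + b) x c a df da).
Qed.

Lemma is_derive_continuous f (df : R -> R) :
  (forall x, is_derive x 1 f (df x)) -> continuous f.
Proof.
move=> h x; apply: differentiable_continuous; apply/derivable1_diffP.
by have [] := h x.
Qed.

Lemma mean_value f (df : R -> R) a b : a <= b -> (forall x, is_derive x 1 f (df x)) ->
  exists2 c, a <= c <= b & f b - f a = df c * (b - a).
Proof.
move=> ab h; have cf : {within `[a, b], continuous f}.
  by apply: continuous_subspaceT; exact: is_derive_continuous h.
have [c cab e] := MVT_segment ab (fun x _ => h x) cf.
by exists c => //; move: cab; rewrite in_itv.
Qed.

Lemma derive0_cst f : (forall x, is_derive x 1 f 0) -> forall x y, f x = f y.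
Proof.
move=> h; have le x y : x <= y -> f x = f y.
  move=> xy; have [c _] := mean_value xy h; rewrite mul0r => /eqP.
  by rewrite subr_eq0 => /eqP.
by move=> x y; case/orP: (le_total x y) => /le // ->.
Qed.

End RealDerivatives.

(** * The periodic Green function and its Fejér means *)

Section GreenFunction.
Variable R : realType.
Implicit Types (x y nu : R) (s t : nat -> R) (k n m : nat).

Definition sinpoly n t x : R := 2 * \sum_(k < n) t k.+1 * sink k.+1 x.

Lemma is_derive_cosk k x :
  is_derive x 1 (cosk k) (- (2 * pi * k%:R * sink k x)).
Proof.
have e : cosk k = fun y : R => cos (2 * pi * k%:R * y + 0).
  by apply/funext => y; rewrite addr0.
rewrite e; apply: (is_derive_eq (is_derive_comp_affine (is_derive_cos _))).
by rewrite addr0 mulrN.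
Qed.

Lemma is_derive_sink k x :
  is_derive x 1 (sink k) (2 * pi * k%:R * cosk k x).
Proof.
have e : sink k = fun y : R => sin (2 * pi * k%:R * y + 0).
  by apply/funext => y; rewrite addr0.
rewrite e; apply: (is_derive_eq (is_derive_comp_affine (is_derive_sin _))).
by rewrite addr0.
Qed.

Lemma sinpolyS n t x :
  sinpoly n.+1 t x = sinpoly n t x + 2 * (t n.+1 * sink n.+1 x).
Proof. by rewrite /sinpoly big_ord_recr /= mulrDr. Qed.

Lemma is_derive_cospoly n t x :
  is_derive x 1 (cospoly n t) (- sinpoly n (fun k => 2 * pi * k%:R * t k) x).
Proof.
elim: n => [|n IH].
  rewrite (_ : cospoly 0 t = cst (t 0%N)); last first.
    by apply/funext => y; rewrite cospoly0.
  apply: (is_derive_eq (is_derive_cst _ _ _)).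
  by rewrite /sinpoly big_ord0 mulr0 oppr0.
rewrite (_ : cospoly n.+1 t =
    fun y => cospoly n t y + 2 * t n.+1 * cosk n.+1 y); last first.
  by apply/funext => y; rewrite cospolyS mulrA.
apply: is_derive_eq (is_derive_add IH
  (is_derive_mulcl (2 * t n.+1) (is_derive_cosk n.+1 x))) _.
by rewrite sinpolyS; ring.
Qed.

Lemma is_derive_sinpoly n t x :
  is_derive x 1 (sinpoly n t) (cospoly n (fun k => 2 * pi * k%:R * t k) x).
Proof.
elim: n => [|n IH].
  rewrite (_ : sinpoly 0 t = cst 0); last first.
    by apply/funext => y; rewrite /sinpoly big_ord0 mulr0.
  apply: (is_derive_eq (is_derive_cst _ _ _)).
  by rewrite cospoly0 mulr0 mul0r.
rewrite (_ : sinpoly n.+1 t =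
    fun y => sinpoly n t y + 2 * t n.+1 * sink n.+1 y); last first.
  by apply/funext => y; rewrite sinpolyS mulrA.
apply: is_derive_eq (is_derive_add IH
  (is_derive_mulcl (2 * t n.+1) (is_derive_sink n.+1 x))) _.
by rewrite cospolyS; ring.
Qed.

Lemma coskD1 k x : cosk k (x + 1) = cosk k x.
Proof.
rewrite /cosk (_ : 2 * pi * k%:R * (x + 1) =
  2 * pi * k%:R * x + (pi *+ 2) *+ k); last first.
  by rewrite -[X in _ = _ + X]mulr_natr -[pi *+ 2]mulr_natr; ring.
by rewrite (periodicn (@cosD2pi R)).
Qed.

Lemma sinkD1 k x : sink k (x + 1) = sink k x.
Proof.
rewrite /sink (_ : 2 * pi * k%:R * (x + 1) =
  2 * pi * k%:R * x + (pi *+ 2) *+ k); last first.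
  by rewrite -[X in _ = _ + X]mulr_natr -[pi *+ 2]mulr_natr; ring.
by rewrite (periodicn (@sinD2pi R)).
Qed.

Lemma cospolyD1 n t x : cospoly n t (x + 1) = cospoly n t x.
Proof. by rewrite /cospoly; under eq_bigr do rewrite coskD1. Qed.

Lemma sinpolyD1 n t x : sinpoly n t (x + 1) = sinpoly n t x.
Proof. by rewrite /sinpoly; under eq_bigr do rewrite sinkD1. Qed.

Lemma cospolyN n t x : cospoly n t (- x) = cospoly n t x.
Proof. by rewrite /cospoly; under eq_bigr do rewrite coskN. Qed.

(* The multiplier of the resolvent [(1 - nu^2 d_xx)^-1] at frequency [k]. *)
Definition resolvent nu k : R := (1 + (2 * pi * nu * k%:R) ^+ 2)^-1.

Lemma resolvent_den_gt0 nu k : 0 < 1 + (2 * pi * nu * k%:R) ^+ 2 :> R.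
Proof. by rewrite ltr_pwDl// sqr_ge0. Qed.

Lemma resolvent_gt0 nu k : 0 < resolvent nu k.
Proof. by rewrite invr_gt0 resolvent_den_gt0. Qed.

Lemma resolvent0 nu : resolvent nu 0 = 1.
Proof. by rewrite /resolvent mulr0 expr0n addr0 invr1. Qed.

(** This is 2 cosh((1/2 - y) / nu), the Green function up to normalisation. It is not periodised and
    represents G only for y in [0, 1]. *)
Definition green nu y : R := expR ((2^-1 - y) / nu) + expR (- ((2^-1 - y) / nu)).

Definition dgreen nu y : R :=
  (expR (- ((2^-1 - y) / nu)) - expR ((2^-1 - y) / nu)) / nu.

Lemma is_derive_green nu x : is_derive x 1 (green nu) (dgreen nu x).
Proof.
have e : green nu = fun y => expR (- nu^-1 * y + 2^-1 / nu) +
    expR (nu^-1 * y - 2^-1 / nu).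
  by apply/funext => y; rewrite /green; congr (expR _ + expR _); ring.
rewrite e; apply: (is_derive_eq (is_derive_add
   (is_derive_comp_affine (is_derive_expR _))
   (is_derive_comp_affine (is_derive_expR _)))).
rewrite /dgreen (_ : - ((2^-1 - x) / nu) = nu^-1 * x + - (2^-1 / nu)); last ring.
rewrite (_ : (2^-1 - x) / nu = - nu^-1 * x + 2^-1 / nu); last ring.
ring.
Qed.

Lemma is_derive_dgreen nu x : is_derive x 1 (dgreen nu) (green nu x / nu ^+ 2).
Proof.
have e : dgreen nu = fun y => nu^-1 * (expR (nu^-1 * y - 2^-1 / nu)
    - expR (- nu^-1 * y + 2^-1 / nu)).
  apply/funext => y; rewrite /dgreen mulrC; congr (_ * (expR _ - expR _)); ring.
rewrite e; apply: (is_derive_eq (is_derive_mulcl _ (is_derive_add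
   (is_derive_comp_affine (is_derive_expR _))
   (is_derive_opp (is_derive_comp_affine (is_derive_expR _)))))).
rewrite /green -exprVn.
have -> : (2^-1 - x) / nu = - nu^-1 * x + 2^-1 / nu by ring.
have -> : - (- nu^-1 * x + 2^-1 / nu) = nu^-1 * x - 2^-1 / nu by ring.
ring.
Qed.

(** The integral of [green nu] over [0, 1], which is also nu^2 times the increment of [dgreen nu]
    from 0 to 1. *)
Definition green_mass nu : R :=
  2 * nu * (expR (2^-1 / nu) - expR (- (2^-1 / nu))).

(* [Phi'] below has a sign by Lagrange's identity for [1 - nu^2 d_xx], and
   [Phi 1 - Phi 0] only sees the jump of the derivative of [green nu] at [0]. *)
Lemma green_le nu M t x B beta : 0 < nu ->
  (forall y, 0 <= y <= 1 -> (green nu y - B) * cospoly M t (y - x) <= beta) ->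
  green_mass nu * cospoly M (fun k => resolvent nu k * t k) x
    <= B * t 0%N + beta.
Proof.
move=> nu0 h.
set a := fun k => resolvent nu k * t k.
set da := fun k => 2 * pi * k%:R * a k.
(* Coefficients of the periodic primitive of [cospoly M t - t 0]. The mean goes into the linear term
   of [Phi], so that in [Phi 1 - Phi 0] only that term and the jump survive. *)
set it := fun k => t k / (2 * pi * k%:R).
pose Phi y := nu ^+ 2 * (- sinpoly M da (1 * y + - x) * green nu y +
  - (cospoly M a (1 * y + - x) * dgreen nu y)) +
  (B * (sinpoly M it (1 * y + - x)) + (B * t 0%N + beta) * y).
pose dPhi y := beta - (green nu y - B) * cospoly M t (y - x).
have dP y : is_derive y 1 Phi (dPhi y).
  have d1 := is_derive_comp_affine (is_derive_sinpoly M da (1 * y + - x)).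
  have d2 := is_derive_comp_affine (is_derive_cospoly M a (1 * y + - x)).
  have d3 := is_derive_comp_affine (is_derive_sinpoly M it (1 * y + - x)).
  have d4 := is_derive_mul (is_derive_opp d1) (is_derive_green nu y).
  have d5 := is_derive_opp (is_derive_mul d2 (is_derive_dgreen nu y)).
  have d6 := is_derive_mulcl (nu ^+ 2) (is_derive_add d4 d5).
  have d7 := is_derive_mulcl (B * t 0%N + beta) (is_derive_id y (1 : R)).
  have d8 := is_derive_add (is_derive_mulcl B d3) d7.
  apply: (is_derive_eq (is_derive_add d6 d8)).
  rewrite /dPhi -/da !mul1r; set z := y - x.
  have e1 : cospoly M t z = cospoly M a z +
      nu ^+ 2 * cospoly M (fun k => 2 * pi * k%:R * da k) z.
    rewrite -cospolyZ -cospolyD; apply: eq_cospoly => k _.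
    have := mulVf (lt0r_neq0 (resolvent_den_gt0 nu k)).
    rewrite -/(resolvent nu k) /da /a => e.
    by rewrite -[LHS]mul1r -[in LHS]e; ring.
  have e2 : cospoly M (fun k => 2 * pi * k%:R * it k) z = cospoly M t z - t 0%N.
    rewrite /cospoly mulr0 mul0r add0r (addrC (t 0%N)) addrK; congr (2 * _).
    apply: eq_bigr => k _; congr (_ * _); rewrite /it mulrC divfK//.
    by rewrite !mulf_neq0// ?pnatr_eq0// (lt0r_neq0 (pi_gt0 R)).
  rewrite e2 !e1 /da; field.
  by rewrite gt_eqF.
have [c c01 e] := mean_value ler01 dP.
have : 0 <= Phi 1 - Phi 0.
  by rewrite e subr0 mulr1 /dPhi subr_ge0 h.
rewrite /Phi !mul1r add0r mulr0 mulr1 addr0 (addrC 1) !cospolyD1 !sinpolyD1.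
rewrite /green /dgreen subr0 cospolyN.
have -> : (2^-1 - 1) / nu = - (2^-1 / nu) by field; rewrite gt_eqF.
rewrite opprK /green_mass; set E := expR (2^-1 / nu); set E' := expR _.
set s1 := sinpoly _ _ _; set s2 := sinpoly _ _ _.
set c1 := cospoly _ _ _ => H.
rewrite -subr_ge0; apply: (le_trans H); rewrite le_eqVlt; apply/orP; left; apply/eqP.
by field; rewrite gt_eqF.
Qed.

Lemma green_mass_gt0 nu : 0 < nu -> 0 < green_mass nu.
Proof.
move=> nu0; rewrite mulr_gt0 ?mulr_gt0// subr_gt0 ltr_expR.
have : 0 < 2^-1 / nu by rewrite divr_gt0.
lra.
Qed.

Lemma green_ge2 nu y : 2 <= green nu y.
Proof.
rewrite /green expRN; set e := expR _.
have e0 : 0 < e by exact: expR_gt0.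
rewrite -subr_ge0 (_ : e + _ - 2 = (e - 1) ^+ 2 / e); last first.
  by field; rewrite gt_eqF.
by rewrite divr_ge0 ?sqr_ge0// ltW.
Qed.

(** The comparison [green_le] is applied to the negated Fejér weights, with B = 2 the minimum of
    [green nu], attained at 1/2. *)
Lemma resolvent_fejer_lower nu M x : 0 < nu ->
  2 / green_mass nu <=
    cospoly M (fun k => resolvent nu k * fejer R M.+1 k) x.
Proof.
move=> nu0.
have := @green_le nu M (fun k => -1 * fejer R M.+1 k) x 2 0 nu0.
under (@eq_cospoly _ _ (fun k => resolvent nu k * _)) do rewrite mulrCA.
rewrite cospolyZ fejer0// => H.
rewrite ler_pdivrMr ?green_mass_gt0// mulrC.
have -> : 2 = - (2 * (-1 * 1) + 0) :> R by ring.
rewrite -lerN2 opprK -mulrN -mulN1r; apply: H => y _.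
rewrite cospolyZ mulN1r mulrN oppr_le0 mulr_ge0 ?fejer_kernel_ge0//.
by rewrite subr_ge0 green_ge2.
Qed.

Lemma resolvent_fejer_ge0 nu M x : 0 < nu ->
  0 <= cospoly M (fun k => resolvent nu k * fejer R M.+1 k) x.
Proof.
move=> nu0; apply: le_trans (resolvent_fejer_lower M x nu0).
by rewrite divr_ge0// ltW// green_mass_gt0.
Qed.

End GreenFunction.

(** * Positivity and majorants of the truncated resolvent kernel *)

Section ResolventKernel.
Variable R : realType.
Implicit Types (x y nu : R) (s t a w : nat -> R) (k n m N M : nat).

Lemma resolventE nu k : resolvent nu k * (1 + (2 * pi * nu * k%:R) ^+ 2) = 1.
Proof. by rewrite mulVf// gt_eqF// resolvent_den_gt0. Qed.

Lemma resolvent_le1 nu k : resolvent nu k <= 1.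
Proof. by rewrite invf_le1 ?resolvent_den_gt0// lerDl sqr_ge0. Qed.

Lemma resolvent_ge0 nu k : 0 <= resolvent nu k.
Proof. exact/ltW/resolvent_gt0. Qed.

Lemma resolvent_nincr nu k : resolvent nu k.+1 <= resolvent nu k.
Proof.
rewrite lef_pV2 ?posrE ?resolvent_den_gt0// lerD2l !exprMn ler_wpM2l//.
  by rewrite mulr_ge0// ?sqr_ge0// mulr_ge0// sqr_ge0.
by rewrite ler_pXn2r ?nnegrE// ler_nat.
Qed.

(** The inflection point of 1 / (1 + xi^2) is at 3 xi^2 = 1. Over the common denominator, with c =
    (2 pi nu)^2, the second difference has numerator 2 c (c (3 (k + 1)^2 - 1) - 1). *)
Lemma resolvent_convex nu k : 1 <= 3 * (2 * pi * nu * k%:R) ^+ 2 ->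
  0 <= resolvent nu k - 2 * resolvent nu k.+1 + resolvent nu k.+2.
Proof.
have := resolventE nu k; have := resolventE nu k.+1.
have := resolventE nu k.+2.
have := resolvent_gt0 nu k; have := resolvent_gt0 nu k.+1.
have := resolvent_gt0 nu k.+2.
set r0 := resolvent nu k; set r1 := resolvent nu k.+1; set r2 := resolvent nu k.+2.
rewrite !exprMn -(natr1 k.+1) -(natr1 k).
have : 0 <= k%:R :> R by [].
set c := 2 ^+ 2 * pi ^+ 2 * nu ^+ 2.
have : 0 <= c by rewrite /c -!exprMn sqr_ge0.
move: (k%:R : R) => K c0 K0 r2_0 r1_0 r0_0 e2 e1 e0 h.
have -> : r0 - 2 * r1 + r2 =
    r0 * r1 * r2 * (2 * c * (c * (3 * (K + 1) ^+ 2 - 1) - 1)).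
  have -> : r0 - 2 * r1 + r2 = r0 * (r1 * (1 + c * (K + 1) ^+ 2)) *
     (r2 * (1 + c * (K + 1 + 1) ^+ 2)) - 2 * r1 *
    (r0 * (1 + c * K ^+ 2)) * (r2 * (1 + c * (K + 1 + 1) ^+ 2)) +
    r2 * (r0 * (1 + c * K ^+ 2)) * (r1 * (1 + c * (K + 1) ^+ 2)).
    by rewrite e2 e1 e0; ring.
  by ring.
have cK : 0 <= c * K by rewrite mulr_ge0.
apply: mulr_ge0; first by rewrite !mulr_ge0// ltW.
by apply: mulr_ge0; [rewrite mulr_ge0 | lra].
Qed.

(** Discrete form of - xi a'(xi) <= 2 a(xi) for a(xi) = 1 / (1 + xi^2). *)
Lemma resolvent_diff nu k :
  k%:R * (resolvent nu k - resolvent nu k.+1) <= 2 * resolvent nu k.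
Proof.
have := resolventE nu k; have := resolventE nu k.+1.
have := resolvent_gt0 nu k; have := resolvent_gt0 nu k.+1.
set r0 := resolvent nu k; set r1 := resolvent nu k.+1.
rewrite !exprMn -(natr1 k).
have : 0 <= k%:R :> R by [].
set c := 2 ^+ 2 * pi ^+ 2 * nu ^+ 2.
have : 0 <= c by rewrite /c -!exprMn sqr_ge0.
move: (k%:R : R) => K c0 K0 r1_0 r0_0 e1 e0.
have -> : r0 - r1 = r0 * r1 * (c * (2 * K + 1)).
  have -> : r0 - r1 = r0 * (r1 * (1 + c * (K + 1) ^+ 2)) -
     r1 * (r0 * (1 + c * K ^+ 2)) by rewrite e0 e1; ring.
  by ring.
have -> : 2 * r0 = r0 * (r1 * (2 * (1 + c * (K + 1) ^+ 2))).
  by rewrite -[LHS]mulr1 -[X in _ * X = _]e1; ring.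
rewrite (_ : K * _ = r0 * (r1 * (K * (c * (2 * K + 1))))); last ring.
have cK : 0 <= c * K by rewrite mulr_ge0.
by rewrite !ler_pM2l//; lra.
Qed.

(** Discrete Leibniz rule: the cross terms are products of first differences of the same sign. *)
Lemma mul_second_diff_ge0 a w k :
  0 <= a k.+1 -> 0 <= w k.+1 -> a k.+1 <= a k -> a k.+2 <= a k.+1 ->
  w k.+1 <= w k -> w k.+2 <= w k.+1 ->
  0 <= a k - 2 * a k.+1 + a k.+2 -> 0 <= w k - 2 * w k.+1 + w k.+2 ->
  0 <= a k * w k - 2 * (a k.+1 * w k.+1) + a k.+2 * w k.+2.
Proof.
move=> a1 w1 a01 a12 w01 w12 ca cw.
have -> : a k * w k - 2 * (a k.+1 * w k.+1) + a k.+2 * w k.+2 =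
  w k.+1 * (a k - 2 * a k.+1 + a k.+2) + a k.+1 * (w k - 2 * w k.+1 + w k.+2)
  + (a k - a k.+1) * (w k - w k.+1) + (a k.+1 - a k.+2) * (w k.+1 - w k.+2).
  ring.
by rewrite !addr_ge0// mulr_ge0// subr_ge0.
Qed.

Lemma fejer_nincr n k : fejer R n k.+1 <= fejer R n k.
Proof. by rewrite /fejer ler_wpM2r ?invr_ge0// ler_nat; lia. Qed.

Lemma fejer_le1 n k : fejer R n k <= 1.
Proof.
case: n => [|n]; first by rewrite /fejer invr0 mulr0.
by rewrite /fejer ler_pdivrMr// mul1r ler_nat leq_subr.
Qed.

(** The coefficients called b_k in the overview. *)
Definition damped_resolvent nu M k : R := resolvent nu k * fejer R M.+1 k.

Lemma damped_ge0 nu M k : 0 <= damped_resolvent nu M k.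
Proof. by rewrite mulr_ge0 ?resolvent_ge0 ?fejer_ge0. Qed.

Lemma damped_le nu M k : damped_resolvent nu M k <= resolvent nu k.
Proof. by rewrite ler_piMr ?resolvent_ge0// fejer_le1. Qed.

Lemma damped_big nu M k : (M < k)%N -> damped_resolvent nu M k = 0.
Proof. by move=> Mk; rewrite /damped_resolvent fejer_big// mulr0. Qed.

Lemma damped0 nu M : damped_resolvent nu M 0 = 1.
Proof. by rewrite /damped_resolvent resolvent0 fejer0// mulr1. Qed.

Lemma damped_nincr nu M k : damped_resolvent nu M k.+1 <= damped_resolvent nu M k.
Proof.
by rewrite ler_pM ?resolvent_ge0 ?fejer_ge0 ?resolvent_nincr ?fejer_nincr.
Qed.

Lemma damped_convex nu M N k : 1 <= 3 * (2 * pi * nu * N%:R) ^+ 2 ->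
  (N <= k)%N -> 0 <= damped_resolvent nu M k - 2 * damped_resolvent nu M k.+1
    + damped_resolvent nu M k.+2.
Proof.
move=> h Nk; apply: mul_second_diff_ge0; rewrite ?resolvent_ge0 ?fejer_ge0
  ?resolvent_nincr ?fejer_nincr ?fejer_convex//.
apply: resolvent_convex; apply: le_trans h _; rewrite ler_pM2l//.
rewrite (exprMn 2 _ N%:R) (exprMn 2 _ k%:R) ler_wpM2l ?sqr_ge0//.
by rewrite ler_pXn2r ?nnegrE// ler_nat.
Qed.

Lemma damped_close nu M k : (k <= M)%N ->
  resolvent nu k - damped_resolvent nu M k <= k%:R / M.+1%:R.
Proof.
move=> kM; rewrite /damped_resolvent fejerE//; last exact: leqW.
rewrite mulrBr mulr1 opprB addrC subrK ler_piMl ?resolvent_le1//.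
Qed.

Lemma damped_diff nu M k : (k <= M)%N -> k%:R *
  (damped_resolvent nu M k - damped_resolvent nu M k.+1) <=
  2 * resolvent nu k + k%:R / M.+1%:R.
Proof.
move=> kM; have := resolvent_diff nu k.
rewrite /damped_resolvent !fejerE//; last exact: leqW.
have := resolvent_le1 nu k.+1; have := resolvent_ge0 nu k.+1.
have := resolvent_nincr nu k; have := resolvent_ge0 nu k.
set r0 := resolvent nu k; set r1 := resolvent nu k.+1 => r00 r10 r1p r11 h.
rewrite -(natr1 k) -[in leRHS](mulr1 k%:R).
have M0 : 0 < (M.+1%:R : R)^-1 by rewrite invr_gt0.
have K0 : 0 <= k%:R :> R by [].
move: h M0 K0; move: (k%:R : R) => K h; move: (M.+1%:R^-1 : R) => m m0 K0.
have -> : K * (r0 * (1 - K * m) - r1 * (1 - (K + 1) * m)) =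
  K * (r0 - r1) - K * K * m * (r0 - r1) + K * m * r1 by ring.
have : 0 <= K * K * m * (r0 - r1).
  by rewrite !mulr_ge0 ?(ltW m0) ?subr_ge0.
have : K * m * r1 <= K * m by rewrite ler_piMr// mulr_ge0 ?(ltW m0).
lra.
Qed.

Lemma exists_nat_inv_le (e : R) m : 0 < e ->
  exists2 M, (m <= M)%N & M.+1%:R^-1 <= e.
Proof.
move=> e0; exists (maxn m (Num.truncn e^-1)); first exact: leq_maxl.
rewrite -[leRHS]invrK lef_pV2 ?posrE ?invr_gt0//.
have /andP[_ /ltW h] : (Num.truncn e^-1)%:R <= e^-1 < (Num.truncn e^-1).+1%:R.
  by rewrite truncn_itv// invr_ge0 ltW.
by rewrite (le_trans h)// ler_nat ltnS leq_maxr.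
Qed.

Lemma inv_sqr_telescope (d y : R) : 0 < d -> 0 < y ->
  ((d * (y + 1)) ^+ 2)^-1 <= (- (y + 1)^-1 - - y^-1) / d ^+ 2.
Proof.
move=> d0 y0; have y1 : 0 < y + 1 by rewrite addr_gt0.
rewrite -subr_ge0.
have -> : (- (y + 1)^-1 - - y^-1) / d ^+ 2 - ((d * (y + 1)) ^+ 2)^-1
       = (y * (d * (y + 1)) ^+ 2)^-1.
  by field; rewrite (gt_eqF y0) (gt_eqF d0) (gt_eqF y1).
by rewrite invr_ge0 mulr_ge0 ?sqr_ge0// ltW.
Qed.

Lemma resolvent_kernel_ge0 nu N x : 0 < nu -> (0 < N)%N ->
  1 / (2 * pi ^+ 2 * nu) * expR (1 / (2 * nu)) <= N%:R ->
  0 <= cospoly N (resolvent nu) x.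
Proof.
move=> nu0 N0 hN; set K := cospoly _ _ _.
have Np : 0 < N%:R :> R by rewrite ltr0n.
set d := 2 * pi * nu.
have d0 : 0 < d by rewrite /d !mulr_gt0// pi_gt0.
suff key M : (N < M)%N -> - (2 * N%:R ^+ 2 * M.+1%:R^-1) <= K.
  rewrite leNgt; apply/negP => K0.
  have [|M NM h] := @exists_nat_inv_le (- K / (4 * N%:R ^+ 2)) N.+1.
    by rewrite divr_gt0 ?mulr_gt0 ?exprn_gt0// oppr_gt0.
  have := key M NM; move: h {key}; rewrite ler_pdivlMr ?mulr_gt0 ?exprn_gt0//.
  have : 0 < N%:R ^+ 2 :> R by rewrite exprn_gt0.
  move: (M.+1%:R^-1) (N%:R ^+ 2) K K0 => q p K' *; nra.
move=> NM.
pose t k := damped_resolvent nu M k - (if (k <= N)%N then resolvent nu k else 0).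
have e : cospoly M (damped_resolvent nu M) x - K = cospoly M t x.
  apply/eqP; rewrite subr_eq; apply/eqP.
  have -> : K = cospoly M (fun k => if (k <= N)%N then resolvent nu k else 0) x.
    rewrite (@cospoly_widen _ N M) ?(ltnW NM)// => [|k].
      by apply: eq_cospoly => k ->.
    by rewrite ltnNge => /negbTE ->.
  by rewrite -cospolyD; apply: eq_cospoly => k _; rewrite /t subrK.
have := cospoly_le_sum M t x; rewrite -e.
rewrite {1}/t leq0n damped0 resolvent0 subrr normr0 add0r => e1.
have e2 : \sum_(k < M) `|t k.+1| <=
    N%:R ^+ 2 * M.+1%:R^-1 + 1 / (d ^+ 2 * N%:R).
  rewrite -(big_mkord xpredT (fun k => `|t k.+1|)).
  rewrite (big_cat_nat (leq0n N) (ltnW NM))//= lerD//.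
    apply: (@le_trans _ _ (\sum_(0 <= k < N) (N%:R * M.+1%:R^-1))).
      apply: ler_sum_nat => k /andP[_ kN]; rewrite /t kN distrC.
      rewrite ger0_norm ?subr_ge0 ?damped_le//.
      apply: (le_trans (damped_close nu (leq_trans kN (ltnW NM)))).
      by rewrite ler_wpM2r ?invr_ge0// ler_nat.
    by rewrite sumr_const_nat subn0 -[leLHS]mulr_natr expr2 mulrAC.
  apply: (@le_trans _ _ (\sum_(N <= k < M) (- (k.+1%:R)^-1 - - (k%:R)^-1) / d ^+ 2)).
    apply: ler_sum_nat => k /andP[Nk kM].
    rewrite /t ltnNge Nk/= subr0 ger0_norm ?damped_ge0//.
    rewrite (le_trans (damped_le _ _ _))//.
    have k0 : 0 < k%:R :> R by rewrite ltr0n (leq_trans N0).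
    apply: (@le_trans _ _ ((d * k.+1%:R) ^+ 2)^-1).
      rewrite lef_pV2 ?posrE ?resolvent_den_gt0 ?lerDr// exprn_gt0//.
      by rewrite (mulr_gt0 d0).
    by rewrite -(natr1 k); exact: inv_sqr_telescope.
  rewrite -mulr_suml telescope_sumr ?(ltnW NM)// div1r [leRHS]invfM mulrC.
  rewrite ler_pM2l ?invr_gt0 ?exprn_gt0// opprK gerDr oppr_le0 invr_ge0//.
(* The threshold on N enters here: it gives green_mass <= 2 nu exp(1 / (2 nu)) <= d^2 N, so twice
   the tail sum stays below the lower bound 2 / green_mass of sigma_M. *)
have e3 : 1 / (d ^+ 2 * N%:R) <= 1 / green_mass nu.
  have dN : 0 < d ^+ 2 * N%:R by exact: mulr_gt0 (exprn_gt0 2 d0) Np.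
  rewrite !div1r lef_pV2 ?posrE ?green_mass_gt0//.
  apply: (@le_trans _ _ (2 * nu * expR (2^-1 / nu))).
    by rewrite /green_mass ler_pM2l ?mulr_gt0// gerDl oppr_le0 expR_ge0.
  have p0 : 0 < 2 * pi ^+ 2 * nu :> R by rewrite !mulr_gt0 ?pi_gt0.
  have e0 : 1 / (2 * nu) = 2^-1 / nu by rewrite invfM mulrA mul1r.
  move: hN; rewrite e0 div1r mulrC ler_pdivrMr//.
  move=> hN; have : 2 * nu * expR (2^-1 / nu) <= 2 * nu * (N%:R * (2 * pi ^+ 2 * nu)).
    by rewrite ler_pM2l// mulr_gt0.
  by move/le_trans; apply; rewrite /d le_eqVlt; apply/orP; left; apply/eqP; ring.
have e4 := @resolvent_fejer_lower R nu M x nu0.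
rewrite -/(damped_resolvent nu M) in e4.
have e5 : cospoly M (damped_resolvent nu M) x - K <= 2 * (N%:R ^+ 2 / M.+1%:R + 1 / (d ^+ 2 * N%:R)).
  by rewrite (le_trans (ler_norm _))// (le_trans e1)// ler_pM2l.
move: e4 e5 e3; rewrite !div1r.
move: (cospoly M _ x) (M.+1%:R^-1) (N%:R ^+ 2) (green_mass nu)^-1.
by move: (d ^+ 2 * N%:R)^-1 (K) => *; lra.
Qed.

Lemma cospoly_natsub_ge0 N M x : (N <= M.+1)%N ->
  0 <= cospoly M (fun k => (N - k)%N%:R) x.
Proof.
move=> NM; apply: cospoly_convex_ge0 => [k _||k _] //.
  by apply/eqP; rewrite pnatr_eq0 subn_eq0.
by rewrite addrAC subr_ge0 -natrM -natrD ler_nat; lia.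
Qed.

Lemma resolvent_kernel_major nu N : 0 < nu -> (0 < N)%N ->
  1 <= 3 * (2 * pi * nu * N%:R) ^+ 2 -> exists (M : nat) s,
  [/\ (N <= M)%N, forall x, `|cospoly N (resolvent nu) x| <= cospoly M s x
  & s 0%N <= 1 + resolvent nu N * (8 + 5 * \sum_(i < N) i.+1%:R^-1)].
Proof.
move=> nu0 N0 hN; set aN := resolvent nu N.
have Np : 0 < N%:R :> R by rewrite ltr0n.
(* With this M the cost E = 2 N^2 / (M + 1) of replacing a_k by b_k for k <= N is at most a_N. *)
have [|M NM hM] := @exists_nat_inv_le (aN / (2 * N%:R ^+ 2)) N.
  by rewrite divr_gt0 ?resolvent_gt0 ?mulr_gt0 ?exprn_gt0.
pose b := damped_resolvent nu M.
pose s := b N - b N.+1.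
have s0 : 0 <= s by rewrite subr_ge0 damped_nincr.
(* Below N the sequence follows the chord of b through N and N + 1: its second differences vanish
   there and agree with those of b from N on. *)
pose c k := if (k <= N)%N then b N + (N - k)%N%:R * s else b k.
pose E := 2 * \sum_(k < N) (N%:R / M.+1%:R : R).
have E0 : 0 <= E.
  by rewrite mulr_ge0// sumr_ge0// => i _; rewrite divr_ge0.
have NN : 0 < 2 * N%:R ^+ 2 :> R by rewrite mulr_gt0// exprn_gt0.
have EE : E = M.+1%:R^-1 * (2 * N%:R ^+ 2).
  by rewrite /E sumr_const card_ord -[X in 2 * X]mulr_natr; ring.
have EaN : E <= aN by rewrite EE -ler_pdivlMr.
have sN : N%:R * s <= 3 * aN.
  apply: (le_trans (damped_diff nu NM)); rewrite -/aN.
  have -> : 3 * aN = 2 * aN + aN by ring.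
  rewrite lerD2l.
  apply: le_trans EaN; rewrite EE mulrC ler_wpM2l ?invr_ge0//.
  have : 1 <= N%:R :> R by rewrite ler1n.
  by move: (N%:R : R) => n n1; nra.
exists M.
(* At 0 these terms are 1, b_N + N s, 5 b_N H, N s and E, with H the harmonic sum. Since N s <= 3
   a_N, the constant is 8 = 1 + 3 + 3 + 1. *)
exists (fun k => b k + c k + b N * dirichlet_major R N k
   + s * (N - k)%N%:R + (if k == 0%N then E else 0)).
split=> // [x|]; last first.
  rewrite /b damped0 -/b /c leq0n subn0 dirichlet_major0 eqxx.
  have bN : b N <= aN by exact: damped_le.
  have b0 : 0 <= b N by exact: damped_ge0.
  have H0 : 0 <= \sum_(i < N) (i.+1%:R : R)^-1.
    by rewrite sumr_ge0// => i _; rewrite invr_ge0.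
  have : b N * (5 * \sum_(i < N) i.+1%:R^-1) <= aN * (5 * \sum_(i < N) i.+1%:R^-1).
    by rewrite ler_wpM2r// mulr_ge0.
  move: sN; rewrite (mulrC s); lra.
pose e k := resolvent nu k - b k.
have -> : cospoly N (resolvent nu) x = cospoly M b x - cospoly M c x +
   b N * cospoly N (fun=> 1) x + s * cospoly N (fun k => (N - k)%N%:R) x
   + cospoly N e x.
  have -> : cospoly M b x - cospoly M c x = cospoly N (fun k => b k - c k) x.
    rewrite -mulN1r -cospolyZ -cospolyD.
    rewrite (@cospoly_widen _ N M)//; first by apply: eq_cospoly => k _; rewrite mulN1r.
    by move=> k; rewrite /c ltnNge => /negbTE ->; rewrite mulN1r subrr.
  rewrite -!cospolyZ -!cospolyD; apply: eq_cospoly => k kN.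
  by rewrite /e /c kN; ring.
have c0 : 0 <= cospoly M c x.
  apply: cospoly_convex_ge0 => [k _||k _].
  - by rewrite /c; case: ifP => _; rewrite ?damped_ge0// addr_ge0 ?damped_ge0 ?mulr_ge0.
  - rewrite /c ltnNge NM/=; exact: damped_big.
  - have [Nk|] := leqP N k.
      have ck j : (N <= j)%N -> c j = b j.
        rewrite /c leq_eqVlt => /predU1P[<-|Nj].
          by rewrite leqnn subnn mul0r addr0.
        by rewrite leqNgt Nj.
      rewrite (ck _ Nk) (ck _ (leqW Nk)) (ck _ (leqW (leqW Nk))).
      exact: damped_convex hN Nk.
    rewrite leq_eqVlt => /predU1P[kN|kN].
      have -> : c k = b N + s by rewrite /c -kN leqnSn subSnn mul1r.
      have -> : c k.+1 = b N by rewrite /c kN leqnn subnn mul0r addr0.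
      have -> : c k.+2 = b N.+1 by rewrite /c kN ltnn.
      by rewrite /s; lra.
    have -> : c k = b N + ((N - k.+2)%:R + 1 + 1) * s.
      by rewrite /c (ltnW (ltnW kN)) !natr1; congr (_ + _%:R * _); lia.
    have -> : c k.+1 = b N + ((N - k.+2)%:R + 1) * s.
      by rewrite /c (ltnW kN) !natr1; congr (_ + _%:R * _); lia.
    have -> : c k.+2 = b N + (N - k.+2)%:R * s by rewrite /c kN.
    by move: (_%:R) => n; lra.
have b0 : 0 <= cospoly M b x by exact: resolvent_fejer_ge0.
rewrite !cospolyD (cospolyZ M (b N)) (cospolyZ M s).
have -> : cospoly M (fun k => if k == 0%N then E else 0) x = E.
  rewrite /cospoly eqxx big1 ?mulr0 ?addr0// => k _; by rewrite mul0r.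
have -> : cospoly M (dirichlet_major R N) x = cospoly N (dirichlet_major R N) x.
  by rewrite !dirichlet_majorE.
have -> : cospoly M (fun k => (N - k)%N%:R) x = cospoly N (fun k => (N - k)%N%:R) x.
  apply: cospoly_widen => // k Nk; apply/eqP; rewrite pnatr_eq0 subn_eq0.
  exact: ltnW.
have f0 := @cospoly_natsub_ge0 N N x (leqnSn N).
have eE : `|cospoly N e x| <= E.
  rewrite (le_trans (cospoly_le_sum _ _ _))//.
  rewrite {1}/e /b damped0 resolvent0 subrr normr0 add0r ler_pM2l//.
  apply: ler_sum => k _; rewrite /e ger0_norm ?subr_ge0 ?damped_le//.
  apply: (le_trans (damped_close nu (leq_trans (ltn_ord k) NM))).
  by rewrite ler_wpM2r ?invr_ge0// ler_nat.
rewrite (le_trans (ler_normD _ _))// lerD//; last first.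
  by rewrite -cospolyD; exact: eE.
rewrite (le_trans (ler_normD _ _))// lerD//; last first.
  by rewrite ger0_norm// mulr_ge0.
rewrite (le_trans (ler_normD _ _))// lerD//; last first.
  rewrite normrM ger0_norm ?damped_ge0// ler_wpM2l ?damped_ge0//.
  exact: dirichlet_major_bound.
by rewrite (le_trans (ler_normB _ _))// !ger0_norm.
Qed.

End ResolventKernel.

(** * Integration on the torus and orthogonality *)

Section TorusIntegral.
Variable R : realType.
Implicit Types (f g h p : R -> R) (x y : R).

Local Notation tau := (torus_measure R).
Local Notation leb := (@lebesgue_measure R).

Lemma torus_measure_sub (A : set R) : measurable A -> A `<=` `[0, 1[ ->
  tau A = leb A.
Proof.
move=> mA A01; transitivity (leb (A `&` `[0, 1[)) => //.
by rewrite setIidl.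
Qed.

Lemma torus_measureT : tau setT = 1%E.
Proof.
transitivity (leb (setT `&` `[0, 1[)) => //.
by rewrite setTI lebesgue_measure_itv/= lte_fin ltr01 sube0.
Qed.

Lemma torus_aeS (P Q : R -> Prop) : (forall x, P x -> Q x) ->
  (\forall x \ae tau, P x) -> \forall x \ae tau, Q x.
Proof.
by move=> PQ; apply: (@filterS _ _ (ae_filter_ringOfSetsType tau)) => x; exact: PQ.
Qed.

Lemma torus_aeS2 (P Q S : R -> Prop) : (forall x, P x -> Q x -> S x) ->
  (\forall x \ae tau, P x) -> (\forall x \ae tau, Q x) ->
  \forall x \ae tau, S x.
Proof.
by move=> PQS; apply: (@filterS2 _ _ (ae_filter_ringOfSetsType tau)) => x; exact: PQS.
Qed.

(** The working class of integrands: the datum f is bounded only almost everywhere, and this class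
    is stable under sums and products and integrable for a finite measure. *)
Definition ess_bounded h := measurable_fun setT h /\
  exists F : R, \forall x \ae tau, `|h x| <= F.

Lemma ess_boundedP h F : measurable_fun setT h -> (forall x, `|h x| <= F) ->
  ess_bounded h.
Proof. by move=> mh hF; split=> //; exists F; apply: nearW. Qed.

Lemma ess_bounded_cst (c : R) : ess_bounded (fun=> c).
Proof. by apply: (@ess_boundedP _ `|c|). Qed.

Lemma ess_boundedD f g : ess_bounded f -> ess_bounded g ->
  ess_bounded (fun x => f x + g x).
Proof.
move=> [mf [F fF]] [mg [G gG]]; split; first exact: measurable_funD.
exists (F + G); apply: torus_aeS2 fF gG => x fF gG.
by rewrite (le_trans (ler_normD _ _))// lerD.
Qed.

Lemma ess_boundedM f g : ess_bounded f -> ess_bounded g ->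
  ess_bounded (fun x => f x * g x).
Proof.
move=> [mf [F fF]] [mg [G gG]]; split; first exact: measurable_funM.
exists (F * G); apply: torus_aeS2 fF gG => x fF gG.
by rewrite normrM ler_pM.
Qed.

Lemma ess_boundedZ (c : R) f : ess_bounded f -> ess_bounded (fun x => c * f x).
Proof. by move=> bf; apply: ess_boundedM => //; exact: ess_bounded_cst. Qed.

Lemma ess_bounded_integrable h : ess_bounded h ->
  tau.-integrable setT (EFin \o h).
Proof.
move=> [mh [F hF]]; apply/integrableP; split; first exact/measurable_EFinP.
apply: (@le_lt_trans _ _ (\int[tau]_x (`|F|)%:E)%E); last first.
  rewrite integral_cst//.
  by rewrite [X in (_ * X)%E]torus_measureT mule1 ltry.
apply: ae_ge0_le_integral => //.
- by apply/measurable_EFinP; exact: measurableT_comp.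
- by apply: torus_aeS hF => x hF _ /=; rewrite lee_fin (le_trans hF)// ler_norm.
Qed.

Lemma torus_intD f g : ess_bounded f -> ess_bounded g ->
  \int[tau]_x (f x + g x) = \int[tau]_x f x + \int[tau]_x g x.
Proof. by move=> bf bg; rewrite RintegralD//; exact: ess_bounded_integrable. Qed.

Lemma torus_intB f g : ess_bounded f -> ess_bounded g ->
  \int[tau]_x (f x - g x) = \int[tau]_x f x - \int[tau]_x g x.
Proof. by move=> bf bg; rewrite RintegralB//; exact: ess_bounded_integrable. Qed.

Lemma torus_intZ (c : R) f : ess_bounded f ->
  \int[tau]_x (c * f x) = c * \int[tau]_x f x.
Proof. by move=> bf; rewrite RintegralZl//; exact: ess_bounded_integrable. Qed.

Lemma ess_bounded_sum n (f : 'I_n -> R -> R) : (forall i, ess_bounded (f i)) ->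
  ess_bounded (fun x => \sum_(i < n) f i x).
Proof.
elim: n f => [|n IH] f bf.
  have -> : (fun x => \sum_(i < 0) f i x) = fun=> 0.
    by apply/funext => x; rewrite big_ord0.
  exact: ess_bounded_cst.
have -> : (fun x => \sum_(i < n.+1) f i x) =
    fun x => \sum_(i < n) f (widen_ord (leqnSn n) i) x + f ord_max x.
  by apply/funext => x; rewrite big_ord_recr.
by apply: ess_boundedD => //; exact: IH.
Qed.

Lemma torus_int_sum n (f : 'I_n -> R -> R) : (forall i, ess_bounded (f i)) ->
  \int[tau]_x (\sum_(i < n) f i x) = \sum_(i < n) \int[tau]_x f i x.
Proof.
elim: n f => [|n IH] f bf.
  rewrite big_ord0; under eq_Rintegral do rewrite big_ord0.
  by rewrite Rintegral_cst// mul0r.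
under eq_Rintegral do rewrite big_ord_recr.
rewrite big_ord_recr torus_intD//= ?IH//.
exact: ess_bounded_sum.
Qed.

Lemma le_torus_int f g : ess_bounded f -> ess_bounded g ->
  (\forall x \ae tau, f x <= g x) -> \int[tau]_x f x <= \int[tau]_x g x.
Proof.
move=> bf bg fg.
have bh : ess_bounded (fun x => g x + -1 * f x).
  by apply: ess_boundedD => //; exact: ess_boundedZ.
rewrite -subr_ge0 -mulN1r -torus_intZ// -torus_intD//; last exact: ess_boundedZ.
set h := (fun x => g x + -1 * f x) in bh *.
(* The inequality h >= 0 holds only almost everywhere; the positive part is nonnegative everywhere
   and has the same integral. *)
rewrite (_ : Rintegral _ _ _ = \int[tau]_x Num.max (h x) 0).
  by apply: Rintegral_ge0 => x _; rewrite le_max lexx orbT.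
congr fine; apply: ae_eq_integral => //.
- by apply/measurable_EFinP; case: bh.
- by apply/measurable_EFinP; apply: measurable_maxr => //; case: bh.
- apply: torus_aeS fg => x fg _; congr EFin; rewrite /h mulN1r.
  by apply/esym/max_idPl; rewrite subr_ge0.
Qed.

(** Hölder's inequality with the integral of a majorant in place of an L^1 norm; for a cosine
    polynomial S that integral is the coefficient at 0. *)
Lemma torus_int_bound p F (T S : R -> R) :
  measurable_fun setT p -> (\forall x \ae tau, `|p x| <= F) ->
  ess_bounded T -> ess_bounded S -> (forall x, `|T x| <= S x) ->
  `|\int[tau]_x (p x * T x)| <= F * \int[tau]_x S x.
Proof.
move=> mp pF bT bS TS.
have bp : ess_bounded p by split=> //; exists F.
have bpT := ess_boundedM bp bT.
rewrite (le_trans (le_normr_Rintegral _ _))//.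
  exact: ess_bounded_integrable.
rewrite -torus_intZ//; apply: le_torus_int.
- have [m [G mG]] := bpT; split; first exact: measurableT_comp.
  by exists G; apply: torus_aeS mG => x; rewrite normr_id.
- exact: ess_boundedZ.
- by apply: torus_aeS pF => x pF; rewrite normrM ler_pM.
Qed.

Lemma torus_int_lebesgue h : ess_bounded h ->
  \int[tau]_x h x = \int[leb]_(x in `[0, 1]) h x.
Proof.
move=> bh; have [mh _] := bh.
have ih := ess_bounded_integrable bh.
have e : forall k : R -> \bar R, measurable_fun setT k ->
    (\int[tau]_x k x = \int[leb]_(x in `[0%R, 1%R]) k x)%E.
  move=> k mk.
  transitivity (\int[tau]_(x in `[0%R, 1%R[) k x)%E.
    rewrite [RHS]integral_mkcond; apply: ae_eq_integral => //.
      by apply/(measurable_restrictT _ _).1 => //; exact: measurable_funTS.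
    exists (~` `[0%R, 1%R[%classic); split.
    - exact: measurableC.
    - transitivity (leb (~` `[0%R, 1%R[ `&` `[0%R, 1%R[)) => //.
      by rewrite setICl measure0.
    - move=> x /= H; rewrite in_itv/= => x01; apply: H => _.
      by rewrite patchE mem_set//= in_itv.
  transitivity (\int[leb]_(x in `[0%R, 1%R[) k x)%E.
    by apply: eq_measure_integral => A mA A01; exact: torus_measure_sub.
  by rewrite integral_itv_bndo_bndc//; exact: measurable_funTS.
by rewrite /Rintegral e//; apply/measurable_EFinP.
Qed.

Lemma Rintegral_derive f (df : R -> R) (a b : R) : a < b ->
  (forall x, is_derive x 1 f (df x)) -> continuous df ->
  \int[leb]_(x in `[a, b]) df x = f b - f a.
Proof.
move=> ab fdf cdf; have cf := is_derive_continuous fdf.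
rewrite /Rintegral (@continuous_FTC2 _ df f)//.
- exact: continuous_subspaceT.
- split => [x _||]; first by have [] := fdf x.
    by apply: cvg_at_right_filter; exact: cf.
  by apply: cvg_at_left_filter; exact: cf.
- by move=> x _; rewrite derive1E; have [_ ->] := fdf x.
Qed.

Lemma continuous_cosk k : continuous (@cosk R k).
Proof. exact: is_derive_continuous (is_derive_cosk k). Qed.

Lemma continuous_sink k : continuous (@sink R k).
Proof. exact: is_derive_continuous (is_derive_sink k). Qed.

Lemma ess_bounded_cosk k : ess_bounded (@cosk R k).
Proof.
apply: (@ess_boundedP _ 1) => [|x]; last exact: cos_max.
by apply: continuous_measurable_fun; exact: continuous_cosk.
Qed.

Lemma ess_bounded_sink k : ess_bounded (@sink R k).
Proof.
apply: (@ess_boundedP _ 1) => [|x]; last exact: sin_max.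
by apply: continuous_measurable_fun; exact: continuous_sink.
Qed.

Lemma torus_int_cosk k : \int[tau]_x cosk k x = (k == 0%N)%:R.
Proof.
case: k => [|k].
  under eq_Rintegral do rewrite cosk0.
  by rewrite Rintegral_cst// torus_measureT/= mulr1.
rewrite torus_int_lebesgue; last exact: ess_bounded_cosk.
have k0 : 2 * pi * k.+1%:R != 0 :> R.
  by rewrite !mulf_neq0// ?pnatr_eq0// (lt0r_neq0 (pi_gt0 R)).
have d x : is_derive x 1 (fun y => (2 * pi * k.+1%:R)^-1 * sink k.+1 y)
    (cosk k.+1 x).
  apply: (is_derive_eq (is_derive_mulcl _ (is_derive_sink _ _))).
  by rewrite mulKf.
have := sinkD1 k.+1 (0 : R); rewrite add0r => e.
by rewrite (Rintegral_derive ltr01 d (@continuous_cosk _)) e subrr.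
Qed.

Lemma torus_int_sink k : \int[tau]_x sink k x = 0.
Proof.
case: k => [|k].
  under eq_Rintegral do rewrite /sink mulr0 mul0r sin0.
  by rewrite Rintegral_cst// mul0r.
rewrite torus_int_lebesgue; last exact: ess_bounded_sink.
have k0 : 2 * pi * k.+1%:R != 0 :> R.
  by rewrite !mulf_neq0// ?pnatr_eq0// (lt0r_neq0 (pi_gt0 R)).
have d x : is_derive x 1 (fun y => - (2 * pi * k.+1%:R)^-1 * cosk k.+1 y)
    (sink k.+1 x).
  apply: (is_derive_eq (is_derive_mulcl _ (is_derive_cosk _ _))).
  by rewrite mulrNN mulKf.
have := coskD1 k.+1 (0 : R); rewrite add0r => e.
by rewrite (Rintegral_derive ltr01 d (@continuous_sink _)) e subrr.
Qed.

Lemma coskB k x y : cosk k (x - y) = cosk k x * cosk k y + sink k x * sink k y.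
Proof. by rewrite /cosk mulrBr cosB. Qed.

Lemma cospoly_shiftE n t x y : cospoly n t (x - y) = t 0%N +
  2 * \sum_(k < n) ((t k.+1 * cosk k.+1 x) * cosk k.+1 y
    + (t k.+1 * sink k.+1 x) * sink k.+1 y).
Proof.
rewrite /cospoly; congr (_ + 2 * _); apply: eq_bigr => k _.
by rewrite coskB; ring.
Qed.

Lemma ess_bounded_cospoly_shift n t x :
  ess_bounded (fun y => cospoly n t (x - y)).
Proof.
have -> : (fun y => cospoly n t (x - y)) = (fun y => t 0%N +
  2 * \sum_(k < n) ((t k.+1 * cosk k.+1 x) * cosk k.+1 y
    + (t k.+1 * sink k.+1 x) * sink k.+1 y)).
  by apply/funext => y; rewrite cospoly_shiftE.
apply: ess_boundedD; first exact: ess_bounded_cst.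
apply/ess_boundedZ/ess_bounded_sum => k; apply: ess_boundedD.
  by apply/ess_boundedZ/ess_bounded_cosk.
by apply/ess_boundedZ/ess_bounded_sink.
Qed.

Lemma ess_bounded_cospoly n t : ess_bounded (cospoly n t).
Proof.
have := @ess_bounded_cospoly_shift n t 0.
by congr ess_bounded; apply/funext => y; rewrite add0r cospolyN.
Qed.

Lemma torus_int_conv n t p x : ess_bounded p ->
  \int[tau]_y (p y * cospoly n t (x - y)) = t 0%N * \int[tau]_y p y +
  2 * \sum_(k < n) t k.+1 * (cosk k.+1 x * \int[tau]_y (p y * cosk k.+1 y)
     + sink k.+1 x * \int[tau]_y (p y * sink k.+1 y)).
Proof.
move=> bp.
have bc k := ess_boundedM bp (ess_bounded_cosk k).
have bs k := ess_boundedM bp (ess_bounded_sink k).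
have e y : p y * cospoly n t (x - y) = t 0%N * p y +
  2 * \sum_(k < n) ((t k.+1 * cosk k.+1 x) * (p y * cosk k.+1 y)
    + (t k.+1 * sink k.+1 x) * (p y * sink k.+1 y)).
  rewrite cospoly_shiftE mulrDr mulrC mulrCA mulr_sumr; congr (_ + 2 * _).
  by apply: eq_bigr => k _; ring.
under eq_Rintegral do rewrite e.
rewrite torus_intD; last 2 first.
- exact: ess_boundedZ.
- apply/ess_boundedZ/ess_bounded_sum => k.
  by apply: ess_boundedD; exact: ess_boundedZ.
rewrite !torus_intZ//; last first.
  by apply/ess_bounded_sum => k; apply: ess_boundedD; exact: ess_boundedZ.
rewrite torus_int_sum; last first.
  by move=> k; apply: ess_boundedD; exact: ess_boundedZ.
congr (_ + 2 * _); apply: eq_bigr => k _.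
by rewrite torus_intD ?torus_intZ//; [ring | exact: ess_boundedZ..].
Qed.

Lemma torus_int_cospoly_mul n t p : ess_bounded p ->
  \int[tau]_y (p y * cospoly n t y) = t 0%N * \int[tau]_y p y +
  2 * \sum_(k < n) t k.+1 * \int[tau]_y (p y * cosk k.+1 y).
Proof.
move=> bp; have := torus_int_conv n t 0 bp.
under eq_Rintegral do rewrite add0r cospolyN.
move=> ->; congr (_ + 2 * _); apply: eq_bigr => k _.
by rewrite cosk_x0 mul1r /sink mulr0 sin0 mul0r addr0.
Qed.

Lemma torus_int_cospoly_shift n t x :
  \int[tau]_y cospoly n t (x - y) = t 0%N.
Proof.
have := torus_int_conv n t x (ess_bounded_cst 1).
under eq_Rintegral do rewrite mul1r.
move=> ->; rewrite Rintegral_cst// torus_measureT/= mul1r mulr1 big1 ?mulr0 ?addr0//.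
move=> k _; under eq_Rintegral do rewrite mul1r.
rewrite torus_int_cosk; under eq_Rintegral do rewrite mul1r.
by rewrite torus_int_sink !mulr0 addr0 mulr0.
Qed.

Lemma torus_int_cospoly n t : \int[tau]_y cospoly n t y = t 0%N.
Proof.
rewrite -(torus_int_cospoly_shift n t 0).
by apply: eq_Rintegral => y _; rewrite add0r cospolyN.
Qed.

Lemma cosk_mul j k x : (k <= j)%N ->
  cosk j x * cosk k x = 2^-1 * (cosk (j + k) x + cosk (j - k) x).
Proof.
move=> kj; rewrite /cosk natrD natrB//.
have -> : 2 * pi * (j%:R + k%:R) * x = 2 * pi * j%:R * x + 2 * pi * k%:R * x.
  by ring.
have -> : 2 * pi * (j%:R - k%:R) * x = 2 * pi * j%:R * x - 2 * pi * k%:R * x.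
  by ring.
by rewrite cosD cosB; field.
Qed.

Lemma torus_int_cosk_mul j k : (0 < k)%N ->
  \int[tau]_x (cosk j x * cosk k x) = (j == k)%:R / 2.
Proof.
move=> k0; wlog kj : j k k0 / (k <= j)%N => [H|].
  have [|jk] := leqP k j; first exact: H.
  case: (posnP j) => [->|j0].
    under eq_Rintegral do rewrite cosk0 mul1r.
    by rewrite torus_int_cosk (gtn_eqF k0) (ltn_eqF k0) mul0r.
  under eq_Rintegral do rewrite mulrC.
  by rewrite (H k j j0 (ltnW jk)) eq_sym.
under eq_Rintegral do rewrite (cosk_mul _ kj).
rewrite torus_intZ; last by apply: ess_boundedD; exact: ess_bounded_cosk.
rewrite torus_intD; [|exact: ess_bounded_cosk..].
rewrite !torus_int_cosk (gtn_eqF (_ : 0 < j + k)%N) ?addn_gt0 ?k0 ?orbT//.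
by rewrite add0r mulrC subn_eq0 eqn_leq kj andbT.
Qed.

Lemma torus_int_cosk_cospoly n t j : \int[tau]_x (cosk j x * cospoly n t x) =
  if (j <= n)%N then t j else 0.
Proof.
rewrite torus_int_cospoly_mul; last exact: ess_bounded_cosk.
rewrite torus_int_cosk; under eq_bigr do rewrite torus_int_cosk_mul//.
case: j => [|j].
  by rewrite mulr1 big1 ?mulr0 ?addr0// => k _; rewrite mul0r mulr0.
rewrite mulr0 add0r; have [jn|nj] := ltnP j n.
  rewrite (bigD1 (Ordinal jn))//= eqxx big1 ?addr0 /=; first by rewrite mulr1n; field.
  by move=> k /negbTE; rewrite -val_eqE/= eqSS eq_sym => ->; rewrite mul0r mulr0.
rewrite big1 ?mulr0// => k _; rewrite eqSS (gtn_eqF (leq_trans _ nj))//.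
by rewrite mul0r mulr0.
Qed.

End TorusIntegral.

(** * Smoothness of trigonometric polynomials *)

Section TrigonometricPolynomials.
Variable R : realType.
Implicit Types (x y : R) (s : seq (R * R * R)).

(* A triple [(omega, a, b)] stands for [a cos (omega x) + b sin (omega x)]. *)
Definition trig s x : R :=
  \sum_(q <- s) (q.1.2 * cos (q.1.1 * x) + q.2 * sin (q.1.1 * x)).

Definition dtrig s := [seq (q.1.1, q.1.1 * q.2, - (q.1.1 * q.1.2)) | q <- s].

Lemma is_derive_trig s x : is_derive x 1 (trig s) (trig (dtrig s) x).
Proof.
elim: s => [|[[w a] b] s IH].
  have -> : trig [::] = cst 0 by apply/funext => y; rewrite /trig big_nil.
  exact: is_derive_cst.
have -> : trig ((w, a, b) :: s) =
    fun y => (a * cos (w * y + 0) + b * sin (w * y + 0)) + trig s y.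
  by apply/funext => y; rewrite /trig big_cons addr0.
have d1 := is_derive_comp_affine (is_derive_cos (w * x + 0)).
have d2 := is_derive_comp_affine (is_derive_sin (w * x + 0)).
have d3 := is_derive_add (is_derive_mulcl a d1) (is_derive_mulcl b d2).
apply: (is_derive_eq (is_derive_add d3 IH)).
by rewrite [in RHS]/trig big_cons /= -/(trig (dtrig s) x) addr0; ring.
Qed.

Lemma derive1n_trig n s : derive1n n (trig s) = trig (iter n dtrig s).
Proof.
elim: n => [//|n IH]; rewrite derive1nS IH; apply/funext => x.
by rewrite derive1E; have [_ ->] := is_derive_trig (iter n dtrig s) x.
Qed.

Lemma smooth_trig s : smooth (trig s).
Proof.
move=> n k x _; rewrite derive1n_trig.
by have [] := is_derive_trig (iter k dtrig s) x.
Qed.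

Lemma continuous_trig s : continuous (trig s).
Proof. exact: is_derive_continuous (is_derive_trig s). Qed.

End TrigonometricPolynomials.

(** * Uniqueness of periodic solutions *)

Section Uniqueness.
Variable R : realType.
Implicit Types (v w : R -> R) (c nu x : R).

(** The function w(x) exp(- c x) is constant; comparing x with x + 1 leaves w(x) (exp(- c) - 1) =
    0. *)
Lemma periodic_exp_ode0 w c : c != 0 -> periodic w 1 ->
  (forall x, is_derive x 1 w (c * w x)) -> forall x, w x = 0.
Proof.
move=> c0 pw dw x.
have d (y : R) : is_derive y 1 (fun z => w z * expR (- c * z + 0)) 0.
  have d1 := is_derive_comp_affine (is_derive_expR (- c * y + 0)).
  by apply: (is_derive_eq (is_derive_mul (dw y) d1)); ring.
have := derive0_cst d (x + 1) x; rewrite pw !addr0 mulrDr mulr1 expRD mulrA.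
set e := expR _; have e0 : e != 0 by rewrite gt_eqF// expR_gt0.
move=> /eqP; rewrite -subr_eq0 -{2}[w x * e]mulr1 -mulrBr mulf_eq0.
rewrite mulf_eq0 (negbTE e0) orbF => /orP[/eqP //|].
by rewrite subr_eq0 -expR0 (inj_eq (@expR_inj R)) oppr_eq0 (negbTE c0).
Qed.

(* [1 - nu^2 d_xx = (1 - nu d_x) (1 + nu d_x)], and a periodic solution of a
   first order equation [w' = c w] with [c != 0] vanishes. *)
Lemma periodic_resolvent_inj v v1 v2 nu : nu != 0 ->
  periodic v 1 -> (forall x, is_derive x 1 v (v1 x)) ->
  (forall x, is_derive x 1 v1 (v2 x)) ->
  (forall x, v x - nu ^+ 2 * v2 x = 0) -> forall x, v x = 0.
Proof.
move=> nu0 pv dv dv1 e.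
have p1 : periodic v1 1.
  move=> x.
  have d := dv (1 * x + 1).
  have := is_derive_comp_affine d; rewrite (_ : (fun y => v (1 * y + 1)) = v).
    move=> [_ h1]; have [_ h2] := dv x.
    by rewrite -h2 h1 !mul1r.
  by apply/funext => y; rewrite mul1r pv.
have p0 x : v x + nu * v1 x = 0.
  apply: (@periodic_exp_ode0 (fun x => v x + nu * v1 x) nu^-1).
  - by rewrite invr_eq0.
  - by move=> y; rewrite pv p1.
  - move=> y; apply: (is_derive_eq (is_derive_add (dv y)
      (is_derive_mulcl nu (dv1 y)))).
    have -> : v y = nu ^+ 2 * v2 y by apply/eqP; rewrite -subr_eq0 e.
    by field.
apply: (@periodic_exp_ode0 v (- nu^-1)) => // [|x].
  by rewrite oppr_eq0 invr_eq0.
apply: (is_derive_eq (dv x)); have -> : v x = - (nu * v1 x).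
  by apply/eqP; rewrite -addr_eq0 p0.
by field.
Qed.

End Uniqueness.

(** * The solution as a multiplier and as a convolution *)

Section Solution.
Variable R : realType.
Local Open Scope complex_scope.
Implicit Types (f u : R -> R[i]) (nu x y : R) (N n : nat).

Local Notation tau := (torus_measure R).

Lemma complexReD (a b : R[i]) : complex.Re (a + b) = complex.Re a + complex.Re b.
Proof. by case: a; case: b. Qed.

Lemma complexImD (a b : R[i]) : complex.Im (a + b) = complex.Im a + complex.Im b.
Proof. by case: a; case: b. Qed.

Lemma complexRe_sum n (F : 'I_n -> R[i]) :
  complex.Re (\sum_(i < n) F i) = \sum_(i < n) complex.Re (F i).
Proof. by apply: (big_morph _ complexReD). Qed.

Lemma complexIm_sum n (F : 'I_n -> R[i]) :
  complex.Im (\sum_(i < n) F i) = \sum_(i < n) complex.Im (F i).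
Proof. by apply: (big_morph _ complexImD). Qed.

Lemma complexP (a b : R[i]) :
  complex.Re a = complex.Re b -> complex.Im a = complex.Im b -> a = b.
Proof. by case: a => a1 a2; case: b => b1 b2 /= -> ->. Qed.

Lemma echar_pos n x : echar n%:Z x = cosk n x +i* sink n x.
Proof. by []. Qed.

Lemma echar_neg n x : echar (- n%:Z) x = cosk n x +i* - sink n x.
Proof. by rewrite /echar mulrNz mulrN mulNr cosN sinN. Qed.

Lemma echarD1 (k : int) x : echar k (x + 1) = echar k x.
Proof.
case: k => n; first by rewrite !echar_pos coskD1 sinkD1.
by rewrite NegzE !echar_neg coskD1 sinkD1.
Qed.

Definition exppoly N (C : nat -> R[i]) x : R[i] :=
  \sum_(j < N.*2.+1) C j * echar (j%:Z - N%:Z) x.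

Definition freq N (j : nat) : R := 2 * pi * (j%:Z - N%:Z)%:~R.

Lemma exppoly_periodic N C : periodic (exppoly N C) 1.
Proof. by move=> x; apply: eq_bigr => j _; rewrite echarD1. Qed.

Lemma exppoly_Re N C x : complex.Re (exppoly N C x) =
  trig [seq (freq N j, complex.Re (C j), - complex.Im (C j)) | j : 'I_(N.*2.+1) <- index_enum 'I_(N.*2.+1)] x.
Proof.
rewrite complexRe_sum /trig big_map.
apply: eq_bigr => j _; rewrite /freq /echar.
by case: (C j) => a b /=; rewrite mulNr.
Qed.

Lemma exppoly_Im N C x : complex.Im (exppoly N C x) =
  trig [seq (freq N j, complex.Im (C j), complex.Re (C j)) | j : 'I_(N.*2.+1) <- index_enum 'I_(N.*2.+1)] x.
Proof.
rewrite complexIm_sum /trig big_map.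
apply: eq_bigr => j _; rewrite /freq /echar.
by case: (C j) => a b /=; rewrite addrC.
Qed.

Lemma dxx_exppoly N C x : dxx (exppoly N C) x =
  exppoly N (fun j => (- freq N j ^+ 2)%:C * C j) x.
Proof.
rewrite /dxx (funext (exppoly_Re N C)) (funext (exppoly_Im N C)) !derive1n_trig.
apply: complexP; rewrite /= ?exppoly_Re ?exppoly_Im /trig /dtrig !big_map;
  apply: eq_bigr => j _ /=; case: (C j) => a b /=; ring.
Qed.

Lemma resolvent_freq nu N j :
  resolvent nu `|j%:Z - N%:Z|%N * (1 + nu ^+ 2 * freq N j ^+ 2) = 1.
Proof.
rewrite -[RHS](resolventE nu `|j%:Z - N%:Z|%N); congr (_ * (1 + _)).
rewrite /freq !exprMn.
have -> : (`|j%:Z - N%:Z|%N%:R : R) ^+ 2 = (j%:Z - N%:Z)%:~R ^+ 2.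
  by rewrite natr_absz intr_norm real_normK// num_real.
ring.
Qed.

Definition solution nu N f : R -> R[i] := exppoly N (fun j =>
  (resolvent nu `|j%:Z - N%:Z|%N)%:C * fourier_coef f (j%:Z - N%:Z)).

Lemma derivable_upto_trig n (g : R -> R) s : g = trig s -> derivable_upto n g.
Proof. by move=> ->; exact: smooth_trig. Qed.

Lemma solutionP nu N f : is_solution nu N f (solution nu N f).
Proof.
split=> [|||x].
- exact: exppoly_periodic.
- exact: derivable_upto_trig (funext (exppoly_Re _ _)).
- exact: derivable_upto_trig (funext (exppoly_Im _ _)).
rewrite dxx_exppoly /fourier_proj /solution /exppoly mulr_sumr -sumrB.
apply: eq_bigr => j _; have := resolvent_freq nu N j.
set r := resolvent _ _; set w := freq _ _ => e.
set c := fourier_coef _ _; set z := echar _ _.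
transitivity ((r * (1 + nu ^+ 2 * w ^+ 2))%:C * (c * z)).
  by rewrite !(rmorphM, rmorphN, rmorphD, rmorph1, rmorphXn) /=; ring.
by rewrite e mul1r.
Qed.

Lemma is_derive_upto2 (g : R -> R) : derivable_upto 2 g ->
  (forall x, is_derive x 1 g (derive1n 1 g x)) /\
  (forall x, is_derive x 1 (derive1n 1 g) (derive1n 2 g x)).
Proof.
move=> h; split=> x; apply: DeriveDef.
- exact: (h 0%N x).
- by rewrite derive1n1 derive1E.
- exact: (h 1%N x).
- exact/esym/derive1E.
Qed.

Lemma eq_sub_cross (a b c d n : R) :
  a - n * b = c - n * d -> (a - c) - n * (b + - d) = 0.
Proof. by move=> e; rewrite -[a](subrK (n * b)) e; ring. Qed.

Lemma complexRe_subM (c a b : R) (z : R[i]) :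
  complex.Re (z - c%:C * (a +i* b)) = complex.Re z - c * a.
Proof. by case: z => z1 z2 /=; ring. Qed.

Lemma complexIm_subM (c a b : R) (z : R[i]) :
  complex.Im (z - c%:C * (a +i* b)) = complex.Im z - c * b.
Proof. by case: z => z1 z2 /=; ring. Qed.

Lemma dxxRe_sub (c : R) u x : complex.Re (u x - c%:C * dxx u x) =
  complex.Re (u x) - c * derive1n 2 (fun y => complex.Re (u y)) x.
Proof. exact: complexRe_subM. Qed.

Lemma dxxIm_sub (c : R) u x : complex.Im (u x - c%:C * dxx u x) =
  complex.Im (u x) - c * derive1n 2 (fun y => complex.Im (u y)) x.
Proof. exact: complexIm_subM. Qed.

Lemma solution_unique nu N f u1 u2 : nu != 0 ->
  is_solution nu N f u1 -> is_solution nu N f u2 -> u1 = u2.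
Proof.
move=> nu0 [p1 r1 i1 e1] [p2 r2 i2 e2].
have [r11 r12] := is_derive_upto2 r1; have [r21 r22] := is_derive_upto2 r2.
have [i11 i12] := is_derive_upto2 i1; have [i21 i22] := is_derive_upto2 i2.
have eR x : (complex.Re (u1 x) - complex.Re (u2 x)) - nu ^+ 2 *
   (derive1n 2 (fun y => complex.Re (u1 y)) x + - derive1n 2 (fun y => complex.Re (u2 y)) x) = 0.
  apply: eq_sub_cross; rewrite -!dxxRe_sub.
  exact: (congr1 (@complex.Re R) (etrans (e1 x) (esym (e2 x)))).
have eI x : (complex.Im (u1 x) - complex.Im (u2 x)) - nu ^+ 2 *
   (derive1n 2 (fun y => complex.Im (u1 y)) x + - derive1n 2 (fun y => complex.Im (u2 y)) x) = 0.
  apply: eq_sub_cross; rewrite -!dxxIm_sub.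
  exact: (congr1 (@complex.Im R) (etrans (e1 x) (esym (e2 x)))).
apply/funext => x; apply: complexP; apply/eqP; rewrite -subr_eq0; apply/eqP.
  apply: (periodic_resolvent_inj nu0 _
    (fun x => is_derive_add (r11 x) (is_derive_opp (r21 x)))
    (fun x => is_derive_add (r12 x) (is_derive_opp (r22 x))) eR).
  by move=> y; rewrite p1 p2.
apply: (periodic_resolvent_inj nu0 _
    (fun x => is_derive_add (i11 x) (is_derive_opp (i21 x)))
    (fun x => is_derive_add (i12 x) (is_derive_opp (i22 x))) eI).
by move=> y; rewrite p1 p2.
Qed.

(** Pairs the frequencies k and -k around the central index N; the induction removes both end terms
    and shifts the index by one. *)
Lemma sum_symmetric (V : zmodType) N (H : nat -> V) :
  \sum_(j < N.*2.+1) H j =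
  H N + \sum_(k < N) (H (N + k.+1)%N + H (N - k.+1)%N).
Proof.
elim: N H => [|N IH] H; first by rewrite big_ord_recr !big_ord0 addrC.
rewrite doubleS big_ord_recr big_ord_recl /= (IH (fun j => H (bump 0 j))).
rewrite [in RHS]big_ord_recr /= subnn.
have -> : \sum_(k < N) (H (bump 0 (N + k.+1)) + H (bump 0 (N - k.+1))) =
    \sum_(k < N) (H (N.+1 + k.+1)%N + H (N.+1 - k.+1)%N).
  by apply: eq_bigr => k _; rewrite /bump /= !add1n addSn subSS subnSK.
rewrite [bump 0 N]add1n (_ : N.*2.+2 = N.+1 + N.+1)%N; last by lia.
by rewrite (addrC (H 0%N)) -!addrA (addrC (H 0%N)).
Qed.

Section Kernel.
Variable f : R -> R[i].
Let p x := complex.Re (f x).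
Let q x := complex.Im (f x).
Hypotheses (bp : ess_bounded p) (bq : ess_bounded q).

Lemma fourier_coef_pos n : fourier_coef f n%:Z =
  (\int[tau]_x (p x * cosk n x) + \int[tau]_x (q x * sink n x)) +i*
  (\int[tau]_x (q x * cosk n x) - \int[tau]_x (p x * sink n x)).
Proof.
have bc := @ess_bounded_cosk R n; have bs := @ess_bounded_sink R n.
rewrite /fourier_coef; congr (_ +i* _).
  rewrite -torus_intD; [|exact: ess_boundedM..].
  apply: eq_Rintegral => x _; rewrite echar_neg /p /q.
  by case: (f x) => a b /=; ring.
rewrite -torus_intB; [|exact: ess_boundedM..].
apply: eq_Rintegral => x _; rewrite echar_neg /p /q.
by case: (f x) => a b /=; ring.
Qed.

Lemma fourier_coef_neg n : fourier_coef f (- n%:Z) =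
  (\int[tau]_x (p x * cosk n x) - \int[tau]_x (q x * sink n x)) +i*
  (\int[tau]_x (q x * cosk n x) + \int[tau]_x (p x * sink n x)).
Proof.
have bc := @ess_bounded_cosk R n; have bs := @ess_bounded_sink R n.
rewrite /fourier_coef opprK; congr (_ +i* _); last first.
  rewrite -torus_intD; [|exact: ess_boundedM..].
  apply: eq_Rintegral => x _; rewrite echar_pos /p /q.
  by case: (f x) => a b /=; ring.
rewrite -torus_intB; [|exact: ess_boundedM..].
apply: eq_Rintegral => x _; rewrite echar_pos /p /q.
by case: (f x) => a b /=; ring.
Qed.

(** An even real multiplier has a real kernel, so the real and imaginary parts of f do not mix. *)
Lemma exppoly_conv N (t : nat -> R) x :
  exppoly N (fun j => (t `|j%:Z - N%:Z|%N)%:C * fourier_coef f (j%:Z - N%:Z)) x =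
  (\int[tau]_y (p y * cospoly N t (x - y))) +i*
  (\int[tau]_y (q y * cospoly N t (x - y))).
Proof.
rewrite !torus_int_conv// /exppoly (sum_symmetric N (fun j =>
  (t `|j%:Z - N%:Z|%N)%:C * fourier_coef f (j%:Z - N%:Z) * echar (j%:Z - N%:Z) x)).
rewrite subrr absz0 (fourier_coef_pos 0) (echar_pos 0).
have e0 h : \int[tau]_x (h x * cosk 0 x) = \int[tau]_x h x.
  by apply: eq_Rintegral => z _; rewrite cosk0 mulr1.
have s0 h : \int[tau]_x (h x * sink 0 x) = 0.
  under eq_Rintegral do rewrite /sink mulr0 mul0r sin0 mulr0.
  by rewrite Rintegral_cst// mul0r.
rewrite !e0 !s0 cosk0.
have S0 : sink 0 x = 0 by rewrite /sink mulr0 mul0r sin0.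
have P k : (N + k.+1)%N%:Z - N%:Z = k.+1%:Z by rewrite PoszD addrC addKr.
have M (k : 'I_N) : (N - k.+1)%N%:Z - N%:Z = - k.+1%:Z.
  by rewrite -subzn// addrAC subrr add0r.
pose A (h : R -> R) (k : nat) := t k.+1 * (cosk k.+1 x * \int[tau]_y (h y * cosk k.+1 y)
  + sink k.+1 x * \int[tau]_y (h y * sink k.+1 y)).
rewrite (eq_bigr (fun k : 'I_N => (2 * A p k) +i* (2 * A q k))) => [|k _].
  by apply: complexP; rewrite ?(complexReD, complexImD, complexRe_sum, complexIm_sum)
    /= S0 -mulr_sumr; ring.
rewrite P M abszN absz_nat fourier_coef_pos fourier_coef_neg echar_pos echar_neg.
by rewrite /A; apply: complexP; rewrite /=; ring.
Qed.

End Kernel.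

End Solution.

(** * Essential suprema, upper bounds and duality *)

Section LinftyNorm.
Variable R : realType.
Local Open Scope complex_scope.
Implicit Types (f u h : R -> R[i]) (nu x y c F : R) (N n : nat).

Local Notation tau := (torus_measure R).
Local Notation normc := ComplexField.Normc.normc.

Lemma normc_ge0 (z : R[i]) : 0 <= normc z.
Proof. by case: z => a b; exact: sqrtr_ge0. Qed.

Lemma sqr_normc (z : R[i]) :
  normc z ^+ 2 = complex.Re z ^+ 2 + complex.Im z ^+ 2.
Proof. by case: z => a b /=; rewrite sqr_sqrtr// addr_ge0 ?sqr_ge0. Qed.

Lemma norm_Re_le (z : R[i]) : `|complex.Re z| <= normc z.
Proof.
rewrite -(@ler_pXn2r _ 2)// ?nnegrE ?normc_ge0// sqr_normc real_normK ?num_real//.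
by rewrite lerDl sqr_ge0.
Qed.

Lemma norm_Im_le (z : R[i]) : `|complex.Im z| <= normc z.
Proof.
rewrite -(@ler_pXn2r _ 2)// ?nnegrE ?normc_ge0// sqr_normc real_normK ?num_real//.
by rewrite lerDr sqr_ge0.
Qed.

(** Cauchy-Schwarz. Projecting on a fixed direction reduces the modulus of a complex integral to a
    real integral without losing a constant. *)
Lemma norm_rotation_le (z : R[i]) (a b : R) : a ^+ 2 + b ^+ 2 <= 1 ->
  `|a * complex.Re z + b * complex.Im z| <= normc z.
Proof.
move=> ab1; rewrite -(@ler_pXn2r _ 2)// ?nnegrE ?normc_ge0// sqr_normc.
rewrite real_normK ?num_real//.
set x := complex.Re z; set y := complex.Im z.
apply: (@le_trans _ _ ((a ^+ 2 + b ^+ 2) * (x ^+ 2 + y ^+ 2))).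
  have := sqr_ge0 (a * y - b * x); lra.
by rewrite ler_piMl// addr_ge0 ?sqr_ge0.
Qed.

Lemma Linfty_normE h :
  Linfty_norm h = ess_sup tau (fun x => (normc (h x))%:E).
Proof.
rewrite /Linfty_norm unlock torus_measureT lte01; congr ess_sup.
by apply/funext => x /=; rewrite ger0_norm// normc_ge0.
Qed.

Lemma Linfty_norm_ge0 h : (0 <= Linfty_norm h)%E.
Proof.
rewrite Linfty_normE; apply: ess_sup_ger => [|x].
  by rewrite torus_measureT lte01.
by rewrite lee_fin normc_ge0.
Qed.

Lemma Linfty_norm_le h c : (forall x, normc (h x) <= c) ->
  (Linfty_norm h <= c%:E)%E.
Proof.
by move=> hc; rewrite Linfty_normE; apply: ess_sup_ler => x; rewrite lee_fin.
Qed.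

Lemma Linfty_norm_ae h F : Linfty_norm h = F%:E ->
  \forall x \ae tau, normc (h x) <= F.
Proof.
rewrite Linfty_normE => hF.
have := ess_sup_ge tau (fun x => (normc (h x))%:E); rewrite hF.
by apply: torus_aeS => x; rewrite lee_fin.
Qed.

(** A null set cannot contain an interval [[0, d[]. Only right neighbourhoods of 0 are usable, as
    the measure lives on [0, 1). *)
Lemma torus_ae_near0 (P : R -> Prop) (e : R) : 0 < e ->
  (\forall x \ae tau, P x) -> exists2 x, 0 <= x < e & P x.
Proof.
move=> e0 [A [mA A0 PA]]; apply: contrapT => H.
pose d := Num.min e 1.
have d0 : 0 < d by rewrite lt_min e0 ltr01.
have sA : `[0, d[ `<=` A.
  move=> x /=; rewrite in_itv/= lt_min => /and3P[x0 xe _].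
  by apply: PA => Px; apply: H; exists x; rewrite ?x0.
have s1 : `[0, d[ `<=` `[0, (1 : R)[.
  by move=> x /=; rewrite !in_itv/= lt_min => /and3P[-> _ ->].
have : (tau `[0%R, d[%classic <= tau A)%E by apply: le_measure; rewrite ?inE.
rewrite A0 torus_measure_sub// lebesgue_measure_itv/= lte_fin d0 sube0.
by rewrite lee_fin leNgt d0.
Qed.

Lemma Linfty_norm_continuous_ge h (r : R -> R) : continuous r ->
  (forall x, r x <= normc (h x)) -> ((r 0)%:E <= Linfty_norm h)%E.
Proof.
move=> cr rh; have := Linfty_norm_ge0 h.
case hF : (Linfty_norm h) => [F| |] // _; last by rewrite leey.
rewrite lee_fin leNgt; apply/negP => Fr.
have /cvgrPdist_lt /(_ _ (_ : 0 < r 0 - F)) := cr 0.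
rewrite subr_gt0 => /(_ Fr) [e /= e0 He].
have [x /andP[x0 xe] hx] := torus_ae_near0 e0 (Linfty_norm_ae hF).
have : `|r 0 - r x| < r 0 - F.
  by apply: He; rewrite /= sub0r normrN ger0_norm.
have := rh x; have := ler_norm (r 0 - r x); lra.
Qed.

Lemma Linfty_norm_realZ (g : R -> R) c : 0 < c ->
  Linfty_norm (to_complex (fun x => c * g x)) =
  (c%:E * Linfty_norm (to_complex g))%E.
Proof.
move=> c0; rewrite !Linfty_normE -ess_sup_pZl//; congr ess_sup.
apply/funext => x /=; rewrite -EFinM; congr EFin.
by rewrite !expr0n /= !addr0 exprMn sqrtrM ?sqr_ge0// !sqrtr_sqr (gtr0_norm c0).
Qed.

Lemma in_Linfty_fin f : in_Linfty f ->
  exists F, [/\ 0 <= F, Linfty_norm f = F%:E,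
  ess_bounded (fun x => complex.Re (f x)) &
  ess_bounded (fun x => complex.Im (f x))].
Proof.
move=> [_ mR mI]; have := Linfty_norm_ge0 f.
case hF : (Linfty_norm f) => [F| |] // F0 _; exists F.
have aeF := Linfty_norm_ae hF.
split=> //; split=> //; exists F; apply: torus_aeS aeF => x.
  exact: le_trans (norm_Re_le _).
exact: le_trans (norm_Im_le _).
Qed.

Lemma is_solutionE nu N f u : 0 < nu -> in_Linfty f -> is_solution nu N f u ->
  forall x, u x =
  (\int[tau]_y (complex.Re (f y) * cospoly N (resolvent nu) (x - y))) +i*
  (\int[tau]_y (complex.Im (f y) * cospoly N (resolvent nu) (x - y))).
Proof.
move=> nu0 bf su x; have [F [_ _ bR bI]] := in_Linfty_fin bf.
have -> : u = solution nu N f.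
  by apply: solution_unique su (solutionP nu N f); rewrite gt_eqF.
exact: exppoly_conv.
Qed.

(** Young's inequality for the convolution, with the mean of a majorant of the kernel as the
    constant. *)
Lemma solution_bound nu N M (s : nat -> R) f u : 0 < nu -> in_Linfty f ->
  is_solution nu N f u ->
  (forall x, `|cospoly N (resolvent nu) x| <= cospoly M s x) ->
  (Linfty_norm u <= (s 0%N)%:E * Linfty_norm f)%E.
Proof.
move=> nu0 bf su hs; have [F [F0 hF bR bI]] := in_Linfty_fin bf.
rewrite hF -EFinM; apply: Linfty_norm_le => x.
set K := fun y => cospoly N (resolvent nu) (x - y).
have bK : ess_bounded K by exact: ess_bounded_cospoly_shift.
have bS := ess_bounded_cospoly_shift M s x.
have key (a b : R) : a ^+ 2 + b ^+ 2 <= 1 ->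
    a * complex.Re (u x) + b * complex.Im (u x) <= s 0%N * F.
  move=> ab; rewrite (is_solutionE nu0 bf su x) /=.
  have b1 := ess_boundedM bR bK; have b2 := ess_boundedM bI bK.
  rewrite -!torus_intZ// -torus_intD; [|exact: ess_boundedZ..].
  rewrite mulrC -(torus_int_cospoly_shift M s x).
  have ba := ess_boundedZ a bR; have bb := ess_boundedZ b bI.
  have [m _] := ess_boundedD ba bb.
  apply: le_trans (torus_int_bound (F := F) m _ bK bS _) => [||y].
  - rewrite (le_trans _ (ler_norm _))// le_eqVlt; apply/orP; left; apply/eqP.
    by apply: eq_Rintegral => y _; rewrite mulrDl !mulrA.
  - apply: torus_aeS (Linfty_norm_ae hF) => y.
    exact: le_trans (norm_rotation_le _ ab).
  - exact: hs.
(* The direction (a, b) is that of [u x]; where [u x] vanishes, a = b = 0 gives the required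
   sign. *)
have := normc_ge0 (u x); rewrite le_eqVlt => /predU1P[<-|r0].
  have := key 0 0; rewrite expr0n /= addr0 !mul0r addr0; apply; exact: ler01.
have := key (complex.Re (u x) / normc (u x)) (complex.Im (u x) / normc (u x)).
have -> : (complex.Re (u x) / normc (u x)) ^+ 2 + (complex.Im (u x) / normc (u x)) ^+ 2 = 1.
  rewrite !expr_div_n -mulrDl -sqr_normc divff// expf_neq0// gt_eqF//.
move=> /(_ (lexx _)); apply: le_trans; rewrite le_eqVlt; apply/orP; left; apply/eqP.
rewrite mulrAC -expr2 [X in _ = _ + X]mulrAC -expr2 -mulrDl -sqr_normc.
by rewrite expr2 mulfK// gt_eqF.
Qed.

(** Since the kernel is even, pairing it with a test function gives the solution at 0. Dividing by
    the exact norm L makes the norm 1; L <= c only improves the bound, and L = 0 would make the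
    pairing vanish. *)
Lemma extremal_of_test nu N s c ell : 0 < nu -> periodic (trig s) 1 ->
  (forall x, `|trig s x| <= c) -> 0 < c -> 0 < ell ->
  ell <= \int[tau]_x (trig s x * cospoly N (resolvent nu) x) ->
  exists (g : R -> R) (u : R -> R[i]),
    [/\ periodic g 1, smooth g, Linfty_norm (to_complex g) = 1%E,
        is_solution nu N (to_complex g) u
      & ((ell / c)%:E <= Linfty_norm u)%E].
Proof.
move=> nu0 pg gc c0 l0 hl; set g := trig s.
have nc (x : R) : normc (to_complex g x) = `|g x|.
  by rewrite /to_complex /= expr0n /= addr0 sqrtr_sqr.
have Lc : (Linfty_norm (to_complex g) <= c%:E)%E.
  by apply: Linfty_norm_le => x; rewrite nc.
have := Linfty_norm_ge0 (to_complex g).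
case hL : (Linfty_norm (to_complex g)) => [L| |] // L0; last by rewrite hL in Lc.
rewrite hL lee_fin in Lc; rewrite lee_fin in L0.
have bg : ess_bounded g.
  apply: (@ess_boundedP _ _ c) => //; apply: continuous_measurable_fun.
  exact: continuous_trig.
have bK := ess_bounded_cospoly N (resolvent nu).
have Lp : 0 < L.
  rewrite lt_neqAle L0 andbT eq_sym; apply/eqP => L00.
  set B := `|resolvent nu 0| + 2 * \sum_(k < N) `|resolvent nu k.+1|.
  have := @torus_int_bound R g L (cospoly N (resolvent nu)) (fun=> B) bg.1.
  move=> /(_ _ bK (ess_bounded_cst B) (cospoly_le_sum _ _)).
  rewrite L00 mul0r; have aeL := Linfty_norm_ae hL.
  move=> H; have : `|\int[tau]_x (g x * cospoly N (resolvent nu) x)| <= 0.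
    apply: H; apply: torus_aeS aeL => x; by rewrite nc L00.
  by move/(le_trans (ler_norm _)); rewrite leNgt (lt_le_trans l0 hl).
pose g1 x := L^-1 * g x.
pose s1 := [seq (q.1.1, L^-1 * q.1.2, L^-1 * q.2) | q <- s].
have g1E : g1 = trig s1.
  apply/funext => x; rewrite /g1 /g /trig big_map mulr_sumr.
  by apply: eq_bigr => q _ /=; ring.
have g1p : periodic g1 1 by move=> x; rewrite /g1 /g pg.
have g1n : Linfty_norm (to_complex g1) = 1%E.
  by rewrite Linfty_norm_realZ ?invr_gt0// hL -EFinM mulVf// gt_eqF.
have cg1 : continuous g1 by rewrite g1E; exact: continuous_trig.
have bf : in_Linfty (to_complex g1).
  split; rewrite ?g1n ?ltry//.
  - by move=> x; rewrite /to_complex g1p.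
  - exact: continuous_measurable_fun.
exists g1, (solution nu N (to_complex g1)); split=> //.
- by rewrite g1E; exact: smooth_trig.
- exact: solutionP.
set u := solution _ _ _.
have su : is_solution nu N (to_complex g1) u by exact: solutionP.
have cu : continuous (fun x => complex.Re (u x)).
  by rewrite (funext (exppoly_Re _ _)); exact: continuous_trig.
apply: le_trans (Linfty_norm_continuous_ge cu _); last first.
  by move=> x; exact: le_trans (ler_norm _) (norm_Re_le _).
rewrite (is_solutionE nu0 bf su 0) /= lee_fin.
have -> : \int[tau]_y (g1 y * cospoly N (resolvent nu) (0 - y)) =
    L^-1 * \int[tau]_x (trig s x * cospoly N (resolvent nu) x).
  rewrite -torus_intZ; last exact: ess_boundedM.
  by apply: eq_Rintegral => y _; rewrite add0r cospolyN /g1 mulrA.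
rewrite mulrC ler_pM ?invr_ge0 ?(ltW c0) ?(ltW l0)//.
by rewrite lef_pV2 ?posrE.
Qed.

End LinftyNorm.

(** * Fejér's polynomial and bounded sine sums *)

Section FejerPolynomial.
Variable R : realType.
Implicit Types (x : R) (n N k : nat).

Local Notation tau := (torus_measure R).

Lemma abel_bound n (D C : nat -> R) : 0 <= D 0%N ->
  (forall i, (i < n)%N -> 0 <= D i.+1 <= D i) -> (forall i, `|C i| <= 1) ->
  `|\sum_(i < n) D i * (C i - C i.+1)| <= 2 * D 0%N.
Proof.
move=> D0 Dd C1; case: n Dd => [|n] Dd.
  by rewrite big_ord0 normr0 mulr_ge0.
(* The partial sum is kept together with its boundary term, so a step costs only [D k - D k.+1];
   this is why the bound reads 2 D_0 - D_k. *)
have key k : (k <= n)%N ->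
    `|\sum_(i < k.+1) D i * (C i - C i.+1) + D k * C k.+1| <= 2 * D 0%N - D k /\ 0 <= D k.
  elim: k => [_|k IH kn].
    rewrite big_ord_recr big_ord0 /= [X in `|X|](_ : _ = D 0%N * C 0%N); last ring.
    by rewrite normrM ger0_norm//; split=> //; have := ler_wpM2l D0 (C1 0%N); lra.
  have [h Dk] := IH (ltnW kn); have /andP[Dk1 Dkk] := Dd k (ltnW kn).
  split=> //; rewrite big_ord_recr /=.
  rewrite [X in `|X|](_ : _ = (\sum_(i < k.+1) D i * (C i - C i.+1) + D k * C k.+1) -
    (D k - D k.+1) * C k.+1); last ring.
  rewrite (le_trans (ler_normB _ _))// normrM ger0_norm ?subr_ge0//.
  have : (D k - D k.+1) * `|C k.+1| <= D k - D k.+1 by rewrite ler_piMr ?subr_ge0.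
  lra.
have [h Dn] := key n (leqnn n).
have : `|D n * C n.+1| <= D n by rewrite normrM ger0_norm// ler_piMr.
set A := \sum_(i < _) _ in h *; move=> h1.
have := ler_normB (A + D n * C n.+1) (D n * C n.+1); rewrite addrK; lra.
Qed.

(** Split at m = floor(1/s) with s = |sin pi x|. Each early term is at most 2s, so they add up to at
    most 2; after multiplication by 2 sin pi x the late ones become differences of cosines, and Abel
    summation bounds them by 1 / ((m + 1) s) <= 1. *)
Lemma sum_sink_bound n x : `|\sum_(i < n) sink i.+1 x / i.+1%:R| <= 3.
Proof.
set s := `|sin (pi * x)|.
have s0 : 0 <= s by rewrite /s.
have term i : `|sink i.+1 x / i.+1%:R| <= 2 * s.
  rewrite normrM normfV normr_nat ler_pdivrMr// /sink.
  have -> : 2 * pi * i.+1%:R * x = (2 * i.+1)%:R * (pi * x) by rewrite natrM; ring.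
  by rewrite (le_trans (norm_sin_natM _ _))// natrM mulrAC.
have part k : k%:R * s <= 1 -> `|\sum_(i < k) sink i.+1 x / i.+1%:R| <= 2.
  move=> ks; rewrite (le_trans (ler_norm_sum _ _ _))//.
  apply: (@le_trans _ _ (\sum_(i < k) 2 * s)); first exact: ler_sum.
  rewrite sumr_const card_ord -mulr_natl; lra.
have [ns|ns] := leP (n%:R * s) 1; first by rewrite (le_trans (part n ns))// ler_nat.
have sp : 0 < s.
  by rewrite lt_neqAle s0 andbT eq_sym; apply/eqP => s00; move: ns; rewrite s00 mulr0 ltr10.
have [m ms] : exists m, m = Num.truncn s^-1 by eexists.
have /andP[m1 m2] : m%:R <= s^-1 < m.+1%:R by rewrite ms truncn_itv// invr_ge0.
have ms1 : m%:R * s <= 1 by rewrite -ler_pdivlMr// div1r.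
have mn : (m <= n)%N.
  by rewrite -(ler_nat R) (le_trans m1)// -div1r ler_pdivrMr// ltW.
rewrite -(big_mkord xpredT (fun i => sink i.+1 x / i.+1%:R)).
rewrite (big_cat_nat (leq0n m) mn)//= big_mkord.
rewrite (le_trans (ler_normD _ _))// (_ : 3 = 2 + 1); last ring.
apply: lerD; first exact: part.
rewrite -(add0n m) big_addn big_mkord.
have e : (2 * sin (pi * x)) * (\sum_(i < n - m) sink (i + m).+1 x / (i + m).+1%:R) =
    \sum_(i < n - m) (i + m).+1%:R^-1 *
   (cos ((2 * (i + m) + 1)%:R * (pi * x)) - cos ((2 * (i.+1 + m) + 1)%:R * (pi * x))).
  rewrite mulr_sumr; apply: eq_bigr => i _; rewrite mulrA [RHS]mulrC; congr (_ / _).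
  rewrite /sink addSn; set j := (i + m)%N; set u := 2 * pi * j.+1%:R * x.
  have -> : (2 * j + 1)%:R * (pi * x) = u - pi * x.
    by rewrite /u natrD natrM -(natr1 j); ring.
  have -> : (2 * j.+1 + 1)%:R * (pi * x) = u + pi * x.
    by rewrite /u natrD natrM; ring.
  by rewrite cosB cosD; ring.
have := @abel_bound (n - m) (fun i => (i + m).+1%:R^-1)
  (fun i => cos ((2 * (i + m) + 1)%:R * (pi * x))).
rewrite -e normrM normrM (ger0_norm (_ : 0 <= 2))// -/s add0n.
move=> H; have {}H : 2 * s * `|\sum_(i < n - m) sink (i + m).+1 x / (i + m).+1%:R|
    <= 2 * m.+1%:R^-1.
  apply: H => [|i _|i].
  - by rewrite invr_ge0.
  - by rewrite invr_ge0 ler0n /= lef_pV2 ?posrE// ler_nat addSn.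
  - exact: cos_max.
rewrite -(ler_pM2l sp) mulr1; rewrite -mulrA ler_pM2l// in H.
rewrite (le_trans H)// -[leRHS]invrK lef_pV2 ?posrE ?invr_gt0//.
exact: ltW.
Qed.

(* The two blocks of frequencies, [N - j] and [N + j], 1 <= j <= N, cancel in
   sup norm, but the truncation at [N] keeps only the first one. *)
Definition fejer_seq N : seq (R * R * R) :=
  [seq (2 * pi * (N - i.+1)%N%:R, i.+1%:R^-1, 0) | i : 'I_N <- index_enum 'I_N] ++
  [seq (2 * pi * (N + i.+1)%N%:R, - i.+1%:R^-1, 0) | i : 'I_N <- index_enum 'I_N].

Lemma trig_fejer_seq N x : trig (fejer_seq N) x =
  \sum_(i < N) i.+1%:R^-1 * (cosk (N - i.+1) x - cosk (N + i.+1) x).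
Proof.
rewrite /trig big_cat /= !big_map -big_split /=; apply: eq_bigr => i _.
by rewrite !mul0r !addr0 /cosk; ring.
Qed.

Lemma trig_fejer_seq_bound N x : `|trig (fejer_seq N) x| <= 6.
Proof.
rewrite trig_fejer_seq.
have -> : \sum_(i < N) i.+1%:R^-1 * (cosk (N - i.+1) x - cosk (N + i.+1) x) =
    2 * sink N x * \sum_(i < N) sink i.+1 x / i.+1%:R.
  rewrite mulr_sumr; apply: eq_bigr => i _.
  rewrite /cosk /sink natrB// natrD.
  have -> : 2 * pi * (N%:R - i.+1%:R) * x = 2 * pi * N%:R * x - 2 * pi * i.+1%:R * x.
    by ring.
  have -> : 2 * pi * (N%:R + i.+1%:R) * x = 2 * pi * N%:R * x + 2 * pi * i.+1%:R * x.
    by ring.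
  by rewrite cosB cosD; ring.
rewrite normrM normrM (ger0_norm (_ : 0 <= 2))//.
have := sum_sink_bound N x; have : `|sink N x| <= 1 by exact: sin_max.
have := normr_ge0 (sink N x).
set A := `|sink N x|; set B := `|\sum_(i < N) _|; nra.
Qed.

Lemma trig_fejer_seq_periodic N : periodic (trig (fejer_seq N)) 1.
Proof.
by move=> x; rewrite !trig_fejer_seq; apply: eq_bigr => i _; rewrite !coskD1.
Qed.

Lemma resolvent_le (nu : R) j k : (j <= k)%N -> resolvent nu k <= resolvent nu j.
Proof.
elim: k => [|k IH]; first by rewrite leqn0 => /eqP ->.
rewrite leq_eqVlt => /predU1P[->//|jk].
exact: le_trans (resolvent_nincr _ _) (IH jk).
Qed.

Lemma fejer_seq_test nu N : resolvent nu N * \sum_(i < N) i.+1%:R^-1 <=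
  \int[tau]_x (trig (fejer_seq N) x * cospoly N (resolvent nu) x).
Proof.
set K := cospoly N (resolvent nu).
have bK : ess_bounded K by exact: ess_bounded_cospoly.
have bcK j : ess_bounded (fun x => cosk j x * K x).
  by apply: ess_boundedM => //; exact: ess_bounded_cosk.
have -> : \int[tau]_x (trig (fejer_seq N) x * K x) =
    \int[tau]_x (\sum_(i < N) i.+1%:R^-1 *
      (cosk (N - i.+1) x * K x - cosk (N + i.+1) x * K x)).
  apply: eq_Rintegral => x _; rewrite trig_fejer_seq mulr_suml.
  by apply: eq_bigr => i _; ring.
have bB i : ess_bounded (fun x => cosk (N - i) x * K x - cosk (N + i) x * K x).
  have -> : (fun x => cosk (N - i) x * K x - cosk (N + i) x * K x) =
    (fun x => cosk (N - i) x * K x + -1 * (cosk (N + i) x * K x)).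
    by apply/funext => x; rewrite mulN1r.
  by apply: ess_boundedD => //; exact: ess_boundedZ.
rewrite torus_int_sum => [|i]; last exact: ess_boundedZ.
rewrite mulr_sumr; apply: ler_sum => i _; rewrite mulrC torus_intZ//.
rewrite ler_wpM2l ?invr_ge0// torus_intB// !torus_int_cosk_cospoly.
have -> : (N + i.+1 <= N)%N = false by lia.
by rewrite leq_subr subr0 resolvent_le// leq_subr.
Qed.

End FejerPolynomial.

(** * Harmonic sums and logarithms *)

Section Harmonic.
Variable R : realType.
Implicit Types (n N : nat).

Lemma harmonic_le n : \sum_(i < n.+1) (i.+1%:R : R)^-1 <= 1 + ln n.+1%:R.
Proof.
elim: n => [|n IH]; first by rewrite big_ord_recr big_ord0 /= add0r invr1 ln1 addr0.
rewrite big_ord_recr /= (le_trans (lerD IH (lexx _)))// -addrA lerD2l.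
have n0 : 0 < n.+1%:R :> R by [].
have n1 : 0 < n.+2%:R :> R by [].
have h : ln (1 + - n.+2%:R^-1) <= - n.+2%:R^-1 :> R.
  by rewrite le_ln1Dx// ltrN2 invf_lt1// ltr1n.
have e : 1 + - n.+2%:R^-1 = n.+1%:R / n.+2%:R :> R.
  have -> : (n.+1%:R : R) = n.+2%:R - 1 by rewrite -(natr1 n.+1) addrK.
  by rewrite mulrBl divff ?mul1r// gt_eqF.
by move: h; rewrite e ln_div ?posrE//; move: (ln _) (ln _) (_^-1) => *; lra.
Qed.

Lemma harmonic_ge n : ln n.+1%:R <= \sum_(i < n) (i.+1%:R : R)^-1.
Proof.
elim: n => [|n IH]; first by rewrite big_ord0 ln1.
rewrite big_ord_recr /=.
have n0 : 0 < n.+1%:R :> R by [].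
have n1 : 0 < n.+2%:R :> R by [].
have h : ln (1 + n.+1%:R^-1) <= n.+1%:R^-1 :> R.
  by rewrite le_ln1Dx// (lt_le_trans _ (_ : 0 <= _))// ?invr_ge0// ltrN10.
have e : 1 + n.+1%:R^-1 = n.+2%:R / n.+1%:R :> R.
  by rewrite -(natr1 n.+1) mulrDl divff ?mul1r// gt_eqF.
move: h IH; rewrite e ln_div ?posrE//.
by move: (ln _) (ln _) (_^-1) (\sum_(_ < _) _) => *; lra.
Qed.

Lemma half_le_ln N : 2^-1 <= ln (N + 2)%:R :> R.
Proof.
apply: (@le_trans _ _ (ln 2)); last by rewrite ler_ln ?posrE ?addn2// ler_nat.
have h : ln (1 + - 2^-1) <= - 2^-1 :> R by rewrite le_ln1Dx//; lra.
have e : 1 + - 2^-1 = 2^-1 :> R by field.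
move: h; rewrite e lnV ?posrE//; lra.
Qed.

End Harmonic.

(** * The maximum principles and the logarithmic lower bound *)

Section MaximumPrinciples.
Variable R : realType.
Implicit Types (nu : R) (N : nat).

Lemma resolvent_pi nu N :
  resolvent nu N = (1 + 4 * (pi * nu * N%:R) ^+ 2)^-1.
Proof. by rewrite /resolvent; congr (_^-1); ring. Qed.

Lemma strict_maximum_principle nu N (f u : R -> R[i]) :
  0 < nu -> (0 < N)%N -> in_Linfty f -> is_solution nu N f u ->
  1 / (2 * pi ^+ 2 * nu) * expR (1 / (2 * nu)) <= N%:R ->
  (Linfty_norm u <= Linfty_norm f)%E.
Proof.
move=> nu0 N0 bf su hN.
have := @solution_bound R nu N N (resolvent nu) f u nu0 bf su.
rewrite resolvent0 mul1e; apply => x.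
by rewrite ger0_norm// resolvent_kernel_ge0.
Qed.

(** With L = ln(N + 2) >= 1/2, the harmonic sum H is at most 3 L, so 8 + 5 H <= 16 L + 15 L; hence
    31. *)
Lemma generalized_maximum_principle nu N (f u : R -> R[i]) :
  0 < nu -> (0 < N)%N -> in_Linfty f -> is_solution nu N f u ->
  (Linfty_norm u <=
     (1 + 31 / (1 + (pi * nu * N%:R) ^+ 2) * ln (N + 2)%:R)%:E * Linfty_norm f)%E.
Proof.
move=> nu0 N0 bf su; set q := (pi * nu * N%:R) ^+ 2; set L := ln _.
have q0 : 0 <= q by exact: sqr_ge0.
have q1 : 0 < 1 + q by rewrite ltr_pwDl.
have L2 : 2^-1 <= L by exact: half_le_ln.
have HL : \sum_(i < N) (i.+1%:R : R)^-1 <= 3 * L.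
  have : ln N%:R <= L by rewrite ler_ln ?posrE ?ltr0n ?addn2// ler_nat; lia.
  have := harmonic_le R N.-1; rewrite prednK//; lra.
have [M [s [hs s0]]] : exists M s,
    (forall x, `|cospoly N (resolvent nu) x| <= cospoly M s x) /\
    s 0%N <= 1 + 31 / (1 + q) * L.
  have [h|h] := leP 1 (3 * (2 * pi * nu * N%:R) ^+ 2).
    have [M [s [_ hs s0]]] := resolvent_kernel_major nu0 N0 h.
    exists M, s; split=> //; rewrite (le_trans s0)// lerD2l.
    rewrite [leRHS](_ : _ = (1 + q)^-1 * (31 * L)); last ring.
    apply: ler_pM.
    - exact: resolvent_ge0.
    - by rewrite addr_ge0// mulr_ge0// sumr_ge0// => i _; rewrite invr_ge0.
    - have q4 : 0 < 1 + 4 * q by rewrite ltr_pwDl// mulr_ge0.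
      by rewrite resolvent_pi -/q lef_pV2 ?posrE// lerD2l ler_peMl// ler1n.
    - by move: HL; move: (\sum_(_ < _) _) => *; lra.
  (* Before the convexity threshold q <= 1, so 1 / (1 + q) >= 1/2 and the Dirichlet bound 5 H <= 15
     L fits into 31 L / 2. *)
  exists N, (dirichlet_major R N); split=> [x|].
    have := @cospoly_decr_bound R N (resolvent nu) x N0 (resolvent_ge0 nu)
      (resolvent_nincr nu).
    by rewrite resolvent0 mul1r.
  rewrite dirichlet_major0.
  have q12 : q <= 1.
    have := h; rewrite (_ : 2 * pi * nu * N%:R = 2 * (pi * nu * N%:R)); last ring.
    by rewrite exprMn -/q; lra.
  have : 2^-1 <= (1 + q)^-1 by rewrite lef_pV2 ?posrE//; lra.
  set r := (1 + q)^-1; nra.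
rewrite (le_trans (solution_bound nu0 bf su hs))// lee_wpmul2r ?Linfty_norm_ge0//.
Qed.

(** The constant is 48 = 4 * 2 * 6: from 1 + 4q <= 4 (1 + q), from N + 2 <= (N + 1)^2 inside the
    logarithm, and from the sup bound 6 of Fejér's polynomial. *)
Lemma resolvent_log_lower nu N : (0 < N)%N ->
  48^-1 / (1 + (pi * N%:R * nu) ^+ 2) * ln (N + 2)%:R <=
  resolvent nu N * (\sum_(i < N) (i.+1%:R : R)^-1) / 6.
Proof.
move=> N0; rewrite resolvent_pi (_ : pi * N%:R * nu = pi * nu * N%:R); last ring.
set q := (pi * nu * N%:R) ^+ 2; set L := ln _.
have q0 : 0 <= q by exact: sqr_ge0.
have L2 : 2^-1 <= L by exact: half_le_ln.
have HL : L / 2 <= \sum_(i < N) (i.+1%:R : R)^-1.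
  apply: le_trans (harmonic_ge R N).
  have : L <= ln ((N.+1%:R : R) ^+ 2).
    rewrite ler_ln ?posrE ?exprn_gt0 ?addn2// -natrX ler_nat; nia.
  rewrite lnXn// mulr2n; lra.
have h : 4^-1 * (1 + q)^-1 <= (1 + 4 * q)^-1.
  have q4 : 0 < 1 + 4 * q by rewrite ltr_pwDl// mulr_ge0.
  by rewrite -invfM lef_pV2 ?posrE ?mulr_gt0 ?ltr_pwDl//; move: q0; lra.
have q1 : 0 < (1 + q)^-1 by rewrite invr_gt0 ltr_pwDl.
move: h q1; set r := (1 + q)^-1; set t := (1 + 4 * q)^-1; set H := \sum_(i < N) _ in HL *.
nra.
Qed.

End MaximumPrinciples.

(** * Oscillation of the kernel near 1/2 *)

Section SmallViscosity.
Variable R : realType.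
Implicit Types (nu x y : R) (N M k : nat).

Local Notation tau := (torus_measure R).
Local Notation leb := (@lebesgue_measure R).

Lemma cos_le_cos (a b : R) : 0 <= a -> a <= b -> b <= pi -> cos b <= cos a.
Proof.
move=> a0; rewrite le_eqVlt => /predU1P[->//|ab bpi].
by apply/ltW; rewrite ltr_cos// in_itv /=; apply/andP; split; lra.
Qed.

(** Half the width of the zone [5/12, 7/12] where G is small: a point of the window is at distance
    at least 1/24 from the complement of the zone, which leaves room for the tails of the Fejér
    kernel. *)
Definition window x := 11 / 24 <= x <= 13 / 24.

Lemma sin_window x : window x -> 2^-1 <= sin (pi * x).
Proof.
move=> /andP[x1 x2]; have p0 := pi_gt0 R.
rewrite -cosBpihalf -cos_norm.
have c2 : cos (pi / 4) ^+ 2 = 2^-1 :> R.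
  have : cos ((pi / 4) *+ 2) = 0 :> R.
    by rewrite (_ : (pi / 4) *+ 2 = pi / 2) ?cos_pihalf// mulr2n; field.
  by rewrite cos_mulr2n mulr2n => h; lra.
have c0 : 0 <= cos (pi / 4) :> R by rewrite cos_ge0_pihalf//; lra.
have h : `|pi * x - pi / 2| <= pi / 4 by rewrite ler_norml; nra.
apply: le_trans (cos_le_cos _ h _) => //; last by lra.
by move: c2 c0; set c := cos _ => *; nra.
Qed.

Lemma sqr_sin_window (z : R) : 24^-1 <= `|z| -> `|z| <= 23 / 24 ->
  sin (pi / 24) ^+ 2 <= sin (pi * z) ^+ 2.
Proof.
move=> z1 z2; have p0 := pi_gt0 R.
rewrite !sin2cos2 lerD2l lerN2 -(cos_norm (pi * z)) normrM (gtr0_norm p0).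
have c1 : cos (pi * `|z|) <= cos (pi / 24) by apply: cos_le_cos; nra.
have c2 : - cos (pi / 24) <= cos (pi * `|z|).
  have -> : - cos (pi / 24) = cos (pi - pi / 24) :> R.
    by rewrite cosB cospi sinpi; ring.
  by apply: cos_le_cos; nra.
move: c1 c2; set a := cos _; set b := cos _ => h1 h2.
by rewrite -subr_ge0 subr_sqr mulr_ge0//; lra.
Qed.

Lemma green_mono nu y y' : 0 < nu -> `|2^-1 - y| <= `|2^-1 - y'| ->
  green nu y <= green nu y'.
Proof.
move=> nu0 h.
have e z : green nu z = expR (`|2^-1 - z| / nu) + expR (- (`|2^-1 - z| / nu)).
  rewrite /green; have [z0|z0] := leP 0 (2^-1 - z); first by rewrite ger0_norm.
  by rewrite ltr0_norm// mulNr opprK addrC.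
rewrite !e; set u := `|_| / nu; set v := `|_| / nu.
have uv : u <= v by rewrite /u /v ler_pM2r ?invr_gt0.
have u0 : 0 <= u by rewrite divr_ge0// ltW.
rewrite !expRN; have eu : 1 <= expR u.
  by rewrite -[leLHS]expR0 ler_expR.
have ev : expR u <= expR v by rewrite ler_expR.
move: eu ev; set a := expR u; set b := expR v => a1 ab.
have a0 : 0 < a by lra.
have b0 : 0 < b by lra.
rewrite -subr_ge0 (_ : _ - _ = (b - a) * (1 - (a * b)^-1)); last first.
  by field; rewrite (gt_eqF a0) (gt_eqF b0).
rewrite mulr_ge0 ?subr_ge0// invf_le1 ?mulr_gt0//; nra.
Qed.

(** The comparison [green_le] with B = [green nu (5 / 12)]: inside the zone [green nu y - B] is
    nonpositive, outside it the Fejér kernel is at most 1 / ((M + 1) sin^2(pi / 24)). *)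
Lemma damped_window_upper nu M x : 0 < nu -> window x ->
  cospoly M (damped_resolvent nu M) x <= (green nu (5 / 12) +
    green nu 0 / (M.+1%:R * sin (pi / 24) ^+ 2)) / green_mass nu.
Proof.
move=> nu0 xI; set q := sin (pi / 24) ^+ 2.
have p0 := pi_gt0 R.
have q0 : 0 < q.
  by rewrite exprn_gt0// sin_gt0_pi//; apply/andP; split; lra.
rewrite ler_pdivlMr ?green_mass_gt0// mulrC.
have := @green_le R nu M (fejer R M.+1) x (green nu (5 / 12))
  (green nu 0 / (M.+1%:R * q)) nu0.
rewrite fejer0// mulr1; apply => y /andP[y0 y1].
have F0 := fejer_kernel_ge0 M (y - x).
have g0 z : 0 <= green nu z by rewrite (le_trans _ (green_ge2 _ _)).
have b0 : 0 <= green nu 0 / (M.+1%:R * q).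
  by rewrite divr_ge0// mulr_ge0// ltW.
move: xI => /andP[x1 x2].
have [h|h] := leP `|2^-1 - y| 12^-1.
  apply: le_trans b0; rewrite mulr_le0_ge0// subr_le0 green_mono//.
  by rewrite (le_trans h)// ler_normr; apply/orP; left; lra.
apply: (@le_trans _ _ (green nu 0 * cospoly M (fejer R M.+1) (y - x))).
  rewrite ler_wpM2r//.
  have gy : green nu y <= green nu 0.
    by rewrite green_mono// subr0 (ger0_norm (_ : 0 <= 2^-1))// ler_norml; lra.
  have := g0 (5 / 12); lra.
have Mq : 0 < M.+1%:R * q by exact: mulr_gt0.
rewrite ler_wpM2l// -[leRHS]div1r ler_pdivlMr//.
have sq : q <= sin (pi * (y - x)) ^+ 2.
  apply: sqr_sin_window; last by rewrite ler_norml; lra.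
  move: h; rewrite lter_normr => /orP h; rewrite ler_normr; apply/orP.
  by case: h => h; [right|left]; lra.
apply: (@le_trans _ _ (cospoly M (fejer R M.+1) (y - x) *
   (M.+1%:R * sin (pi * (y - x)) ^+ 2))).
  by rewrite ler_wpM2l// ler_wpM2l.
rewrite mulrC fejer_kernelE.
have := sin_max (M.+1%:R * (pi * (y - x))).
by rewrite -(real_normK (num_real (sin _))) => h1; rewrite expr_le1.
Qed.

(* Two Abel summations, against the conjugate kernels of [D_k] and [F_k]. *)
Lemma cospoly_tail_abel (b : nat -> R) N m x :
  2 * sin (pi * x) * ((cospoly (N + m) b x - cospoly N b x) * sin (pi * x)
    + b N.+1 * sin ((2 * N + 1)%:R * (pi * x))
    - b (N + m).+1 * sin ((2 * (N + m) + 1)%:R * (pi * x))) =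
  \sum_(i < m) (b (N + i).+1 - b (N + i).+2) *
     (cosk (N + i).+1 x - cosk (N + i.+1).+1 x).
Proof.
have step j : 2 * sin (pi * x) * sin ((2 * j.+1 + 1)%:R * (pi * x)) =
    cosk j.+1 x - cosk j.+2 x.
  rewrite /cosk; set u := (2 * j.+1 + 1)%:R * (pi * x).
  have -> : 2 * pi * j.+1%:R * x = u - pi * x.
    by rewrite /u natrD natrM; ring.
  have -> : 2 * pi * j.+2%:R * x = u + pi * x.
    by rewrite /u natrD natrM -(natr1 j.+1); ring.
  by rewrite cosB cosD; ring.
have step1 j : 2 * cosk j.+1 x * sin (pi * x) =
    sin ((2 * j.+1 + 1)%:R * (pi * x)) - sin ((2 * j + 1)%:R * (pi * x)).
  rewrite /cosk; set v := 2 * pi * j.+1%:R * x.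
  have -> : (2 * j + 1)%:R * (pi * x) = v - pi * x.
    by rewrite /v natrD natrM -(natr1 j); ring.
  have -> : (2 * j.+1 + 1)%:R * (pi * x) = v + pi * x.
    by rewrite /v natrD natrM; ring.
  by rewrite sinB sinD; ring.
elim: m => [|m IH].
  by rewrite addn0 big_ord0 subrr mul0r; ring.
rewrite big_ord_recr /= -IH addnS cospolyS.
rewrite -step mulrC; have := step1 (N + m)%N.
move: (sin ((2 * (N + m).+1 + 1)%:R * _)) (sin ((2 * (N + m) + 1)%:R * _)) => s1 s0 h.
have {h} : cosk (N + m).+1 x * sin (pi * x) * 2 = s1 - s0 by rewrite -h; ring.
move: (cosk (N + m).+1 x) (cospoly (N + m) b x) (cospoly N b x)
  (sin (pi * x)) => c A B s h.
have -> : (A + 2 * (b (N + m).+1 * c) - B) * s = (A - B) * s + b (N + m).+1 * (s1 - s0).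
  by rewrite -h; ring.
ring.
Qed.

(** The coefficient at M + 1 vanishes, so the far boundary term is absent; by convexity the first
    differences decrease, and [abel_bound] applies to them. *)
Lemma cospoly_tail_bound nu N M x (b := damped_resolvent nu M) : (N < M)%N -> 0 < sin (pi * x) ->
  1 <= 3 * (2 * pi * nu * N%:R) ^+ 2 ->
  `|(cospoly M b x - cospoly N b x) * sin (pi * x)
     + b N.+1 * sin ((2 * N + 1)%:R * (pi * x))| * sin (pi * x) <= b N.+1 - b N.+2.
Proof.
move=> NM s0 hN.
have := cospoly_tail_abel b N (M - N) x; rewrite subnKC ?(ltnW NM)//.
rewrite /b (damped_big nu (ltnSn M)) -/b mul0r subr0.
set A := _ + _ => e.
have := @abel_bound R (M - N) (fun i => b (N + i).+1 - b (N + i).+2)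
  (fun i => cosk (N + i).+1 x).
rewrite -e addn0 => H.
suff : 2 * (`|A| * sin (pi * x)) <= 2 * (b N.+1 - b N.+2) by rewrite ler_pM2l.
have -> : 2 * (`|A| * sin (pi * x)) = `|2 * sin (pi * x) * A|.
  by rewrite !normrM (ger0_norm (_ : 0 <= 2))// (gtr0_norm s0); ring.
apply: H => [|i _|i]; last exact: norm_cosk.
  by rewrite subr_ge0 damped_nincr.
rewrite subr_ge0 damped_nincr/= -subr_ge0 addnS.
have := @damped_convex R nu M N (N + i).+1 hN (leqW (leq_addr _ _)).
rewrite -/b; lra.
Qed.

(** With S = sin((2N + 1) pi x), the factor sin pi x cancels the denominator of the oscillating part
    of the kernel. Subtracting twice this test from 1 contributes a_{N+1} (S^2 - S) to leading
    order, with mean a_{N+1} / 2, while 1 - S >= 0 keeps the test in [0, 1]. *)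
Definition window_test N x := sin (pi * x) * (1 - sin ((2 * N + 1)%:R * (pi * x))) / 2.

Lemma window_test_ge0 N x : window x -> 0 <= window_test N x <= 1.
Proof.
move=> /sin_window h; rewrite /window_test.
have := sin_le1 (pi * x); have := sin_le1 ((2 * N + 1)%:R * (pi * x)).
have := sin_geN1 ((2 * N + 1)%:R * (pi * x)).
move: h; move: (sin (pi * x)) (sin ((2 * N + 1)%:R * _)) => s S s2 S1 S2 s1.
have s0 : 0 <= s by lra.
have sS : 0 <= s * (1 - S) by rewrite mulr_ge0// subr_ge0.
have sS2 : s * (1 - S) <= 1 * 2 by apply: ler_pM => //; lra.
by apply/andP; split; lra.
Qed.

Lemma window_kernel_upper nu N M x (B : R) (b := damped_resolvent nu M)
  (S := sin ((2 * N + 1)%:R * (pi * x))) : (N < M)%N -> 0 < nu -> 0 <= B ->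
  1 <= 3 * (2 * pi * nu * N%:R) ^+ 2 -> window x ->
  cospoly M b x <= B ->
  b N.+1 * (S ^+ 2 - S) - (4 * (b N.+1 - b N.+2) + 2 * B) <=
   - 2 * window_test N x * cospoly N b x.
Proof.
move=> NM nu0 B0 hN xI sB; have sx := sin_window xI.
have /andP[t0 t1] := window_test_ge0 N xI.
have s0 : 0 < sin (pi * x) by apply: lt_le_trans sx.
have := cospoly_tail_bound NM s0 hN; rewrite /= -/b -/S.
set E := _ + _ => hE.
have D0 : 0 <= b N.+1 - b N.+2 by rewrite subr_ge0 damped_nincr.
have E2 : `|E| <= 2 * (b N.+1 - b N.+2).
  have := normr_ge0 E; nra.
have S1 : -1 <= S by exact: sin_geN1.
have S2 : S <= 1 by exact: sin_le1.
have sg0 : 0 <= cospoly M b x by exact: resolvent_fejer_ge0.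
have -> : - 2 * window_test N x * cospoly N b x =
   - 2 * window_test N x * cospoly M b x + (1 - S) * (E - b N.+1 * S).
  by rewrite /window_test -/S /E; field.
have h1 : window_test N x * cospoly M b x <= B.
  by rewrite (le_trans _ sB)// ler_piMl.
have h2 : - (4 * (b N.+1 - b N.+2)) <= (1 - S) * E.
  have : `|(1 - S) * E| <= 4 * (b N.+1 - b N.+2).
    rewrite normrM ger0_norm ?subr_ge0//; have := normr_ge0 E; nra.
  by rewrite ler_norml => /andP[].
lra.
Qed.

(** Half the window length is 20/480. With om = (2N + 1) pi >= 1200, the oscillating terms of the
    primitive cost at most (1/2 + 2) / om <= 1/480. *)
Lemma window_integral_lower N (b kap : R) : (300 <= N)%N -> 0 <= b ->
  b * (19 / 480) - kap / 12 <= \int[leb]_(x in `[11 / 24, 13 / 24])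
   (b * (sin ((2 * N + 1)%:R * (pi * x)) ^+ 2 - sin ((2 * N + 1)%:R * (pi * x))) - kap).
Proof.
move=> N300 b0; pose om : R := (2 * N + 1)%:R * pi.
have om0 : 1200 <= om.
  have N3 : 300 <= N%:R :> R by rewrite (ler_nat R 300).
  have p2 := pi_ge2 R.
  rewrite /om natrD natrM; nra.
have omp : 0 < om by lra.
pose df x := b * (sin (om * x) ^+ 2 - sin (om * x)) - kap.
pose f x := b * (2^-1 * x + 0 + (- (4 * om)^-1 * sin (2 * om * x + 0) +
   om^-1 * cos (om * x + 0))) + (- kap * x + 0).
have fdf x : is_derive x 1 f (df x).
  have d1 := is_derive_comp_affine (is_derive_sin (2 * om * x + 0)).
  have d2 := is_derive_comp_affine (is_derive_cos (om * x + 0)).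
  have d3 := is_derive_add (is_derive_mulcl (- (4 * om)^-1) d1)
    (is_derive_mulcl om^-1 d2).
  have d4 := is_derive_add (is_derive_affine 2^-1 0 x) d3.
  apply: (is_derive_eq (is_derive_add (is_derive_mulcl b d4) (is_derive_affine (- kap) 0 x))).
  rewrite !addr0 /df (_ : 2 * om * x = (om * x) *+ 2); last by rewrite mulr2n; ring.
  by rewrite cos_mulr2n cos2sin2 mulr2n; field; rewrite gt_eqF.
have cdf : continuous df.
  have e : df = fun x => b * (sin (om * x + 0) * sin (om * x + 0) + - sin (om * x + 0)) + - kap.
    by apply/funext => x; rewrite /df addr0.
  rewrite e.
  have d x : is_derive x 1 (fun x => sin (om * x + 0)) (om * cos (om * x + 0)).
    exact: is_derive_comp_affine (is_derive_sin _).
  have dd x := is_derive_add (is_derive_mulcl b (is_derive_add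
    (is_derive_mul (d x) (d x)) (is_derive_opp (d x)))) (is_derive_cst (- kap) x 1).
  exact: (is_derive_continuous dd).
rewrite (_ : Rintegral _ _ _ = \int[leb]_(x in `[11 / 24, 13 / 24]) df x); last first.
  by apply: eq_Rintegral => x _; rewrite /df /om mulrA.
rewrite (Rintegral_derive _ fdf cdf); last by lra.
rewrite /f !addr0.
have := sin_max (2 * om * (13 / 24)); have := sin_max (2 * om * (11 / 24)).
have := cos_max (om * (13 / 24)); have := cos_max (om * (11 / 24)).
move: (sin _) (sin _) (cos _) (cos _) => s1 s2 c1 c2.
rewrite !ler_norml => /andP[c2a c2b] /andP[c1a c1b] /andP[s2a s2b] /andP[s1a s1b].
have oi : 0 < om^-1 by rewrite invr_gt0.
have oi2 : om^-1 * 1200 <= 1 by rewrite -[leRHS](mulVf (lt0r_neq0 omp)) (ler_pM2l oi).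
rewrite invfM; move: om^-1 oi oi2 => o oi oi2.
have h1 : - o <= o * c1 <= o by nra.
have h2 : - o <= o * c2 <= o by nra.
have h3 : - o <= o * s1 <= o by nra.
have h4 : - o <= o * s2 <= o by nra.
move: h1 h2 h3 h4 => /andP[? ?] /andP[? ?] /andP[? ?] /andP[? ?].
nra.
Qed.

End SmallViscosity.

(** * Smoothing the test function; sizes of multiplier and Green function *)

Section SmallViscosityLower.
Variable R : realType.
Implicit Types (nu x y : R) (N M k : nat) (p : R -> R).

Local Notation tau := (torus_measure R).
Local Notation leb := (@lebesgue_measure R).

Definition cos_seq M (t : nat -> R) : seq (R * R * R) :=
  (0, t 0%N, 0) ::
  [seq (2 * pi * k.+1%:R, 2 * t k.+1, 0) | k : 'I_M <- index_enum 'I_M].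

Lemma trig_cos_seq M t x : trig (cos_seq M t) x = cospoly M t x.
Proof.
rewrite /trig big_cons big_map /= mul0r cos0 mulr1 mul0r addr0 /cospoly.
congr (_ + _); rewrite mulr_sumr; apply: eq_bigr => k _.
by rewrite mul0r addr0 mulrA.
Qed.

Definition cos_coef p k : R := \int[tau]_x (p x * cosk k x).

(* Only the even part of the Fejér mean is kept, so that no sine occurs. *)
Definition fejer_mean M p k : R := fejer R M.+1 k * cos_coef p k.

Lemma cos_coef0 p : cos_coef p 0 = \int[tau]_x p x.
Proof. by apply: eq_Rintegral => x _; rewrite cosk0 mulr1. Qed.

(** The polynomial is the average of the Fejér means of p at x and at -x, each bounded by 1 because
    the Fejér kernel is nonnegative of mean one. *)
Lemma fejer_mean_bound M p x : measurable_fun setT p -> (forall y, `|p y| <= 1) ->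
  `|cospoly M (fejer_mean M p) x| <= 1.
Proof.
move=> mp p1; have bp := ess_boundedP mp p1.
set F := fejer R M.+1.
have key z : `|\int[tau]_y (p y * cospoly M F (z - y))| <= 1.
  have bF := ess_bounded_cospoly_shift M F z.
  have := @torus_int_bound R p 1 _ _ mp _ bF bF.
  rewrite torus_int_cospoly_shift /F fejer0// mulr1; apply => [|y].
    by apply: nearW.
  by rewrite ger0_norm// fejer_kernel_ge0.
have -> : cospoly M (fejer_mean M p) x = 2^-1 *
    (\int[tau]_y (p y * cospoly M F (x - y)) + \int[tau]_y (p y * cospoly M F (- x - y))).
  rewrite !torus_int_conv// /cospoly /fejer_mean cos_coef0.
  set A := \sum_(k < M) _; set B := \sum_(k < M) _; set D := \sum_(k < M) _.
  have -> : B = 2 * A - D.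
    rewrite /A /B /D mulr_sumr -sumrB; apply: eq_bigr => k _.
    by rewrite coskN /sink mulrN sinN /cos_coef /F; ring.
  by rewrite /F; field.
have := key x; have := key (- x).
move: (\int[_]_y _) (\int[_]_y _) => a b; rewrite !ler_norml => /andP[??] /andP[??].
by apply/andP; split; lra.
Qed.

(** Fejér averaging is self-adjoint: smoothing p amounts to damping the coefficients of the kernel,
    so the rough function can be tested instead. *)
Lemma fejer_mean_test M N p (a : nat -> R) : (N <= M)%N -> ess_bounded p ->
  \int[tau]_x (cospoly M (fejer_mean M p) x * cospoly N a x) =
  \int[tau]_x (p x * cospoly N (fun k => a k * fejer R M.+1 k) x).
Proof.
move=> NM bp; rewrite !torus_int_cospoly_mul//; last exact: ess_bounded_cospoly.
rewrite torus_int_cospoly -cos_coef0 /fejer_mean mulrA; congr (_ + 2 * _).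
apply: eq_bigr => k _; rewrite -mulrA; congr (_ * _).
under eq_Rintegral do rewrite mulrC.
by rewrite torus_int_cosk_cospoly (leq_trans (ltn_ord k) NM).
Qed.

Definition window_sign N x : R :=
  1 - 2 * (if window x then window_test N x else 0).

Lemma continuous_sin_affine (a : R) : continuous (fun x => sin (a * x + 0)).
Proof. by apply: is_derive_continuous => x; exact: is_derive_comp_affine (is_derive_sin _). Qed.

Lemma measurable_sin_mul (a : R) : measurable_fun setT (fun x => sin (a * x)).
Proof.
have -> : (fun x => sin (a * x)) = (fun x => sin (a * x + 0)).
  by apply/funext => x; rewrite addr0.
apply: continuous_measurable_fun; exact: continuous_sin_affine.
Qed.

Lemma measurable_window (h : R -> R) : measurable_fun setT h ->
  measurable_fun setT (fun x => if window x then h x else 0).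
Proof.
move=> mh; apply: measurable_fun_ifT => //.
by apply: measurable_and; apply: measurable_fun_ler.
Qed.

Lemma measurable_window_test N : measurable_fun setT (window_test N : R -> R).
Proof.
rewrite /window_test; apply: measurable_funM => //; apply: measurable_funM.
  exact: measurable_sin_mul.
apply: measurable_funB => //.
under eq_fun do rewrite mulrA.
exact: measurable_sin_mul.
Qed.

Lemma measurable_window_sign N : measurable_fun setT (window_sign N).
Proof.
apply: measurable_funB => //; apply: measurable_funM => //.
by apply: measurable_window; exact: measurable_window_test.
Qed.

Lemma window_sign_le1 N x : `|window_sign N x| <= 1.
Proof.
rewrite /window_sign; case: ifP => [xI|_]; last by rewrite mulr0 subr0 normr1.
by have /andP[h1 h2] := window_test_ge0 N xI; rewrite ler_norml; apply/andP; split; lra.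
Qed.

Lemma window_test_integral nu N M (B : R) (b := damped_resolvent nu M) :
  (300 <= N)%N -> (N < M)%N -> 0 < nu -> 0 <= B ->
  1 <= 3 * (2 * pi * nu * N%:R) ^+ 2 ->
  (forall x, window x -> cospoly M b x <= B) ->
  1 + b N.+1 * (19 / 480) - (4 * (b N.+1 - b N.+2) + 2 * B) / 12 <=
  \int[tau]_x (window_sign N x * cospoly N b x).
Proof.
move=> N300 NM nu0 B0 hN sB; set kap := 4 * _ + 2 * B.
pose h x : R := b N.+1 * (sin ((2 * N + 1)%:R * (pi * x)) ^+ 2 - sin ((2 * N + 1)%:R * (pi * x))) - kap.
pose hI x : R := if window x then h x else 0.
have mh : measurable_fun setT h.
  have m : measurable_fun setT (fun x : R => sin ((2 * N + 1)%:R * (pi * x))).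
    by under eq_fun do rewrite mulrA; exact: measurable_sin_mul.
  apply: measurable_funB => //; apply: measurable_funM => //.
  by apply: measurable_funB => //; exact: measurable_funX.
have b0 : 0 <= b N.+1 by exact: damped_ge0.
have bh : ess_bounded hI.
  apply: (@ess_boundedP _ _ (b N.+1 * 2 + `|kap|)); first exact: measurable_window.
  move=> x; rewrite /hI /h; case: ifP => _; last first.
    by rewrite normr0 addr_ge0// mulr_ge0.
  rewrite (le_trans (ler_normB _ _))// lerD2r normrM ger0_norm// ler_wpM2l//.
  have := sin_le1 ((2 * N + 1)%:R * (pi * x)); have := sin_geN1 ((2 * N + 1)%:R * (pi * x)).
  by move: (sin _) => s s1 s2; rewrite ler_norml; apply/andP; split; nra.
have bK := ess_bounded_cospoly N b.
have bp := ess_boundedP (measurable_window_sign N) (window_sign_le1 N).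
have I1 : 1 + \int[tau]_x hI x <= \int[tau]_x (window_sign N x * cospoly N b x).
  rewrite -(damped0 nu M) -/b -(torus_int_cospoly N b) -torus_intD//.
  apply: le_torus_int.
  - exact: ess_boundedD.
  - exact: ess_boundedM.
  - apply: nearW => x; rewrite /window_sign /hI; case: ifP => [xI|_].
      have := window_kernel_upper NM nu0 B0 hN xI (sB x xI).
      rewrite -/b -/kap -/(h x); move: (h x) (window_test N x) (cospoly N b x).
      by move=> u v w *; lra.
    by rewrite mulr0 subr0 mul1r addr0.
apply: le_trans I1; rewrite -addrA lerD2l.
apply: le_trans (window_integral_lower kap N300 b0) _.
rewrite le_eqVlt; apply/orP; left; apply/eqP.
rewrite torus_int_lebesgue//.
have -> : `[11 / 24, 13 / 24]%classic = `[0, 1]%classic `&` `[11 / 24, 13 / 24]%classic :> set R.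
  apply/seteqP; split=> x /=; rewrite !in_itv /=; last by case.
  by move=> /andP[x1 x2]; split=> //; apply/andP; split; lra.
rewrite Rintegral_mkcondr; apply: eq_Rintegral => x _; rewrite patchE /hI /h.
by rewrite mem_setE in_itv.
Qed.

(** With c = (2 pi nu)^2, the bounds 1 <= 3 c N^2 and (N + 1)^2 <= 4 N^2 give 1 + c (N + 1)^2 <= 7 c
    N^2 = 28 pi^2 nu^2 N^2. The upper limit on N then bounds nu N^2 by C^2 e^4, where e = exp(1 /
    (12 nu)). *)
Lemma resolvent_lower nu N (C : R) : 0 < nu -> 0 < C -> (0 < N)%N ->
  1 <= 3 * (2 * pi * nu * N%:R) ^+ 2 ->
  N%:R <= C * (1 / Num.sqrt nu * expR (1 / (6 * nu))) ->
  1 <= resolvent nu N.+1 * (28 * pi ^+ 2 * C ^+ 2 * nu * expR (1 / (12 * nu)) ^+ 4).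
Proof.
move=> nu0 C0 N0 h1 h2; set e := expR (1 / (12 * nu)).
have N1 : 1 <= N%:R :> R by rewrite ler1n.
have e2 : expR (1 / (6 * nu)) = e ^+ 2.
  by rewrite -expRM_natl; congr expR; field; rewrite gt_eqF.
have h3 : N%:R ^+ 2 * nu <= C ^+ 2 * e ^+ 4.
  have sn : 0 < Num.sqrt nu by rewrite sqrtr_gt0.
  have : N%:R * Num.sqrt nu <= C * e ^+ 2.
    move: h2; rewrite e2 (_ : C * _ = C * e ^+ 2 / Num.sqrt nu); last by rewrite div1r; ring.
    by rewrite ler_pdivlMr.
  move=> h; rewrite -[nu in leLHS](sqr_sqrtr (ltW nu0)) -exprMn.
  rewrite (_ : C ^+ 2 * e ^+ 4 = (C * e ^+ 2) ^+ 2); last ring.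
  have C2 : 0 <= C * e ^+ 2 by rewrite mulr_ge0 ?ltW// exprn_gt0// expR_gt0.
  by rewrite ler_pXn2r ?nnegrE// mulr_ge0// ltW.
rewrite /resolvent mulrC ler_pdivlMr ?resolvent_den_gt0// mul1r -(natr1 N).
have -> : 28 * pi ^+ 2 * C ^+ 2 * nu * e ^+ 4 = 28 * pi ^+ 2 * nu * (C ^+ 2 * e ^+ 4).
  by ring.
apply: (@le_trans _ _ (28 * pi ^+ 2 * nu * (N%:R ^+ 2 * nu))); last first.
  by rewrite ler_wpM2l// mulr_ge0 ?(ltW nu0)// mulr_ge0// sqr_ge0.
move: h1; rewrite !exprMn (_ : 28 * pi ^+ 2 * nu * (N%:R ^+ 2 * nu) = 7 * (2 ^+ 2 * pi ^+ 2 * nu ^+ 2 * N%:R ^+ 2)); last ring.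
have c0 : 0 <= 2 ^+ 2 * pi ^+ 2 * nu ^+ 2 by rewrite -!exprMn sqr_ge0.
move: (2 ^+ 2 * pi ^+ 2 * nu ^+ 2) c0 (N%:R : R) N1 => c c0 n n1 h.
have : c * (n + 1) ^+ 2 <= c * (4 * n ^+ 2) by rewrite ler_wpM2l//; nra.
lra.
Qed.

(** In powers of e = exp(1 / (12 nu)) >= 2, the numerator is e + 1/e <= 2e and the mass is at least
    nu e^6. *)
Lemma green_ratio nu : 0 < nu -> nu <= 12^-1 ->
  green nu (5 / 12) / green_mass nu * (nu * expR (1 / (12 * nu)) ^+ 5) <= 2.
Proof.
move=> nu0 nu1; set e := expR (1 / (12 * nu)).
have e6 : expR (2^-1 / nu) = e ^+ 6.
  by rewrite -expRM_natl; congr expR; field; rewrite gt_eqF.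
have e1 : 2 <= e.
  have : 1 <= 1 / (12 * nu) by rewrite ler_pdivlMr ?mulr_gt0//; lra.
  by have := expR_ge1Dx (1 / (12 * nu)); rewrite -/e; lra.
have gE : green nu (5 / 12) = e + e^-1.
  rewrite /green expRN; congr (_ + _^-1); congr expR; field; rewrite gt_eqF//.
have ei : e^-1 <= 1 by rewrite invf_le1//; lra.
have e60 : 2 <= e ^+ 6.
  by rewrite (le_trans e1)// -[leLHS]expr1 ler_weXn2l//; lra.
have mE : nu * e ^+ 6 <= green_mass nu.
  rewrite /green_mass expRN e6.
  have : (e ^+ 6)^-1 <= 1 by rewrite invf_le1//; lra.
  move: (e ^+ 6) ((e ^+ 6)^-1) e60 => E Ei E2 Ei1; nra.
rewrite mulrAC ler_pdivrMr ?green_mass_gt0// gE.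
apply: (@le_trans _ _ (2 * (nu * e ^+ 6))); last by rewrite ler_pM2l.
rewrite (_ : 2 * (nu * e ^+ 6) = (2 * e) * (nu * e ^+ 5)); last ring.
rewrite ler_wpM2r//; last lra.
by rewrite mulr_ge0 ?(ltW nu0)// exprn_ge0//; lra.
Qed.

End SmallViscosityLower.

(** * Choice of parameters for small nu *)

Section SmallViscosityTheorem.
Variable R : realType.
Implicit Types (nu C : R) (N M : nat).

Lemma mul_le_of_le_div (a c k x i : R) : 0 <= i -> 0 < k -> x <= k ->
  i <= a / (c * k) -> x * i <= a / c.
Proof.
move=> i0 k0 xk ik; apply: (@le_trans _ _ (k * i)); first by rewrite ler_wpM2r.
apply: le_trans (ler_wpM2l (ltW k0) ik) _; rewrite invfM.
have -> : k * (a * (c^-1 * k^-1)) = a / c * (k / k) by ring.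
by rewrite divff ?mulr1// gt_eqF.
Qed.

Lemma damped_test_gain nu N C : 0 < nu -> 0 < C -> (300 <= N)%N ->
  nu <= 12^-1 -> nu * (12 * (112 * 100 * pi ^+ 2 * C ^+ 2)) <= 1 ->
  1 <= 3 * (2 * pi * nu * N%:R) ^+ 2 ->
  N%:R <= C * (1 / Num.sqrt nu * expR (1 / (6 * nu))) ->
  exists2 M, (N < M)%N & 1 + 100^-1 * resolvent nu N.+1 <=
    \int[torus_measure R]_x
      (window_sign N x * cospoly N (damped_resolvent nu M) x).
Proof.
move=> nu0 C0 N300 nu12 nuC hN hC; set a := resolvent nu N.+1.
have a0 : 0 < a by exact: resolvent_gt0.
have N0 : (0 < N)%N by exact: leq_trans N300.
have n300 : 300 <= N.+1%:R :> R by rewrite (ler_nat R 300) leqW.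
have n0 : 0 < N.+1%:R :> R by [].
have p0 := pi_gt0 R.
set q := sin (pi / 24) ^+ 2 : R.
have q0 : 0 < q.
  by rewrite exprn_gt0// sin_gt0_pi//; apply/andP; split; lra.
have m0 := green_mass_gt0 nu0; set m := green_mass nu in m0 *.
have g0 : 0 <= green nu 0 by rewrite (le_trans _ (green_ge2 _ _)).
set G0 := green nu 0 / (q * m).
have G00 : 0 <= G0 by rewrite divr_ge0// ltW// mulr_gt0.
have G1 : green nu (5 / 12) / m <= a / 200.
  have := green_ratio nu0 nu12; have := resolvent_lower nu0 C0 N0 hN hC.
  have : 1 / (12 * nu) <= expR (1 / (12 * nu)).
    by have := expR_ge1Dx (1 / (12 * nu)); lra.
  have : 0 < expR (1 / (12 * nu)) by exact: expR_gt0.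
  rewrite -/a -/m; set e := expR _; set G := _ / m => e0 ez al gl.
  (* The number is 200 * 2 * 28: target a / 200, the 2 of [green_ratio] and the 28 of
     [resolvent_lower]. It is absorbed by e >= 1 / (12 nu), the spare power of e. *)
  have {}ez : 112 * 100 * pi ^+ 2 * C ^+ 2 <= e.
    apply: le_trans ez; rewrite ler_pdivlMr ?mulr_gt0//; lra.
  have ne : 0 < nu * e ^+ 5 by rewrite mulr_gt0// exprn_gt0.
  rewrite -(ler_pM2r ne); apply: (le_trans gl).
  apply: (@le_trans _ _ (2 * (a * (28 * pi ^+ 2 * C ^+ 2 * nu * e ^+ 4)))); first lra.
  have ane : 0 <= a / 200 * nu * e ^+ 4.
    by rewrite !mulr_ge0 ?(ltW a0) ?(ltW nu0) ?exprn_ge0 ?(ltW e0).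
  have := ler_wpM2l ane ez.
  by rewrite exprS; move: (pi ^+ 2) (C ^+ 2) (e ^+ 4) => p c e4; lra.
have e1 : 0 < a / (10 * 100 * N.+1%:R) by rewrite divr_gt0// !mulr_gt0.
have e2 : 0 < a / (10 * 100 * (1 + G0)) by rewrite divr_gt0// !mulr_gt0// ltr_pwDl.
have [M NM] : exists2 M, (N.+1 <= M)%N &
    M.+1%:R^-1 <= Num.min (a / (10 * 100 * N.+1%:R)) (a / (10 * 100 * (1 + G0))).
  by apply: exists_nat_inv_le; rewrite lt_min e1.
rewrite le_min => /andP[i1 i2]; exists M => //.
have i0 : 0 < M.+1%:R^-1 :> R by rewrite invr_gt0.
set i := M.+1%:R^-1 in i0 i1 i2 *.
have {}i1 : N.+1%:R * i <= a / (10 * 100).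
  exact: (mul_le_of_le_div (ltW i0) n0 (lexx _) i1).
have {}i2 : G0 * i <= a / (10 * 100).
  apply: (mul_le_of_le_div (ltW i0) _ _ i2); first by rewrite ltr_pwDl.
  by rewrite lerDr.
set B := (green nu (5 / 12) + green nu 0 / (M.+1%:R * q)) / m.
have BE : B = green nu (5 / 12) / m + G0 * i.
  by rewrite /B mulrDl /G0 /i !invfM; ring.
have B0 : 0 <= B.
  rewrite BE; apply: addr_ge0; last by rewrite mulr_ge0// ltW.
  by apply: divr_ge0; [exact: le_trans (green_ge2 _ _) | exact: ltW].
apply: le_trans (window_test_integral N300 NM nu0 B0 hN _); last first.
  by move=> x; exact: damped_window_upper.
(* In units of a: [b N.+1] >= 0.999, D <= 2.001 / 300 and B <= 0.006, so 0.999 * 19/480 - (4 D + 2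
   B) / 12 is above 0.036, more than the required 1/100. *)
have := damped_close nu NM; have := damped_diff nu NM.
rewrite -/a -/i; set b := damped_resolvent nu M; set D := b N.+1 - b N.+2.
have D0 : 0 <= D by rewrite subr_ge0 damped_nincr.
have D3 : 300 * D <= N.+1%:R * D by rewrite ler_wpM2r.
rewrite -/(b N.+1) => h1 h2.
move: h1 h2 i1 i2 BE G1 D3 a0 {nuC hN hC}.
move: (N.+1%:R * D) (N.+1%:R * i) (G0 * i) (green nu (5 / 12) / m).
by move: (B) (D) (b N.+1) (a) => *; lra.
Qed.

Lemma small_viscosity_lower_bound C : 0 < C ->
  exists c : R, 0 < c /\
   forall (nu : R) (N : nat),
     0 < nu -> nu <= c -> (1 <= N)%N ->
     1 / (2 * Num.sqrt 3 * pi * nu) <= N%:R ->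
     N%:R <= C * (1 / Num.sqrt nu * expR (1 / (6 * nu))) ->
     exists (g : R -> R) (u : R -> R[i]),
       [/\ periodic g 1, smooth g, Linfty_norm (to_complex g) = 1%E,
           is_solution nu N (to_complex g) u
         & ((1 + 100^-1 / (1 + 4 * pi ^+ 2 * nu ^+ 2 * (N%:R + 1) ^+ 2))%:E
            <= Linfty_norm u)%E].
Proof.
move=> C0; have p0 := pi_gt0 R; have p2 := pihalf_lt2 R.
have K0 : 0 < 12 * (112 * 100 * pi ^+ 2 * C ^+ 2) :> R.
  by rewrite !mulr_gt0// exprn_gt0.
(* The first threshold forces N >= 1 / (16 nu) >= 300, as 2 sqrt(3) pi <= 16; the second makes exp(1
   / (12 nu)) large compared with C^2. *)
exists (Num.min (48 * 100)^-1 (12 * (112 * 100 * pi ^+ 2 * C ^+ 2))^-1).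
split=> [|nu N nu0]; first by rewrite lt_min !invr_gt0 K0 mulr_gt0.
rewrite le_min => /andP[nu1 nu2] N1 hN hC.
have {}nu1 : nu * (48 * 100) <= 1.
  by rewrite -ler_pdivlMr ?div1r// mulr_gt0.
have {}nu2 : nu * (12 * (112 * 100 * pi ^+ 2 * C ^+ 2)) <= 1.
  by rewrite -ler_pdivlMr ?div1r.
have s0 : 0 < Num.sqrt 3 :> R by rewrite sqrtr_gt0.
have s3 : Num.sqrt 3 ^+ 2 = 3 :> R by rewrite sqr_sqrtr.
have s2 : Num.sqrt 3 <= 2 :> R by nra.
have d0 : 0 < 2 * Num.sqrt 3 * pi * nu by rewrite !mulr_gt0.
move: hN; rewrite ler_pdivrMr// => hN.
have N300 : (300 <= N)%N.
  rewrite -(ler_nat R) leNgt; apply/negP => N3.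
  have N0 : 0 <= N%:R :> R by [].
  have h : 2 * Num.sqrt 3 * pi * nu <= 16 * nu.
    rewrite ler_pM2r// (_ : 16 = 2 * 2 * 4); last ring.
    apply: (@le_trans _ _ (2 * 2 * pi)).
      by rewrite (ler_pM2r p0) ler_pM2l.
    have p4 : pi <= 4 :> R by lra.
    by rewrite ler_wpM2l// mulr_ge0.
  have : N%:R * (2 * Num.sqrt 3 * pi * nu) <= N%:R * (16 * nu) by rewrite ler_wpM2l.
  have : N%:R * (16 * nu) < 300 * (16 * nu) by rewrite ltr_pM2r// mulr_gt0.
  move: (N%:R * _) (N%:R * _) hN => *; lra.
(* The lower limit on N, squared, is exactly the convexity threshold. *)
have h3 : 1 <= 3 * (2 * pi * nu * N%:R) ^+ 2.
  rewrite -s3 -exprMn.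
  rewrite (_ : Num.sqrt 3 * (2 * pi * nu * N%:R) = N%:R * (2 * Num.sqrt 3 * pi * nu)); last ring.
  by rewrite exprn_ege1.
have [|M NM hM] := damped_test_gain nu0 C0 N300 _ nu2 h3 hC; first lra.
set p := window_sign N in hM.
have mp := measurable_window_sign (R := R) N.
have bp := ess_boundedP mp (window_sign_le1 N).
have h1 : periodic (trig (cos_seq M (fejer_mean M p))) 1.
  by move=> x; rewrite !trig_cos_seq cospolyD1.
have h2 x : `|trig (cos_seq M (fejer_mean M p)) x| <= 1.
  by rewrite trig_cos_seq; apply: fejer_mean_bound => //; exact: window_sign_le1.
have h4 : 0 < 1 + 100^-1 * resolvent nu N.+1.
  by rewrite addr_gt0// mulr_gt0// resolvent_gt0.
have h5 : 1 + 100^-1 * resolvent nu N.+1 <= \int[torus_measure R]_x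
    (trig (cos_seq M (fejer_mean M p)) x * cospoly N (resolvent nu) x).
  under eq_Rintegral do rewrite trig_cos_seq.
  by rewrite fejer_mean_test// ltnW.
have [g [u [pg sg ng su lu]]] := extremal_of_test nu0 h1 h2 ltr01 h4 h5.
exists g, u; split=> //; apply: le_trans lu.
rewrite lee_fin divr1 lerD2l /resolvent ler_pM2l ?invr_gt0//.
rewrite le_eqVlt; apply/orP; left; apply/eqP; congr (_^-1).
by rewrite -(natr1 N); ring.
Qed.

End SmallViscosityTheorem.

Theorem theorem2p2 (R : realType) :
  (* well-posedness of the equation *)
  (forall (nu : R) (N : nat) (f : R -> R[i]),
     0 < nu -> (1 <= N)%N -> in_Linfty f ->
     exists! u : R -> R[i], is_solution nu N f u)
  /\
  (* (i) strict maximum principle *)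
  (forall (nu : R) (N : nat) (f u : R -> R[i]),
     0 < nu -> (1 <= N)%N -> in_Linfty f -> is_solution nu N f u ->
     1 / (2 * pi ^+ 2 * nu) * expR (1 / (2 * nu)) <= N%:R ->
     (Linfty_norm u <= Linfty_norm f)%E)
  /\
  (* (ii) generalized maximum principle *)
  (exists alpha1 : R, 0 < alpha1 /\
   forall (nu : R) (N : nat) (f u : R -> R[i]),
     0 < nu -> (1 <= N)%N -> in_Linfty f -> is_solution nu N f u ->
     (Linfty_norm u <=
        (1 + alpha1 / (1 + (pi * nu * N%:R) ^+ 2) * ln (N + 2)%:R)%:E
        * Linfty_norm f)%E)
  /\
  (* (iii) lower bound *)
  (exists alpha2 : R, 0 < alpha2 /\
   forall (nu : R) (N : nat),
     0 < nu -> (1 <= N)%N ->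
     exists (g : R -> R) (u : R -> R[i]),
       [/\ periodic g 1, smooth g, Linfty_norm (to_complex g) = 1%E,
           is_solution nu N (to_complex g) u
         & ((alpha2 / (1 + (pi * N%:R * nu) ^+ 2) * ln (N + 2)%:R - 1)%:E
            <= Linfty_norm u)%E])
  /\
  (* (iv) lower bound for small nu; C is the implicit constant in the upper
     bound on N, and the smallness threshold c may depend on it *)
  (exists alpha3 : R, 0 < alpha3 /\
   forall C : R, 0 < C ->
   exists c : R, 0 < c /\
   forall (nu : R) (N : nat),
     0 < nu -> nu <= c -> (1 <= N)%N ->
     1 / (2 * Num.sqrt 3 * pi * nu) <= N%:R ->
     N%:R <= C * (1 / Num.sqrt nu * expR (1 / (6 * nu))) ->
     exists (g : R -> R) (u : R -> R[i]),
       [/\ periodic g 1, smooth g, Linfty_norm (to_complex g) = 1%E,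
           is_solution nu N (to_complex g) u
         & ((1 + alpha3 / (1 + 4 * pi ^+ 2 * nu ^+ 2 * (N%:R + 1) ^+ 2))%:E
            <= Linfty_norm u)%E]).
Proof.
split; [|split; [|split; [|split]]].
- move=> nu N f nu0 N1 bf; exists (solution nu N f); split=> [|u su].
    exact: solutionP.
  by apply: solution_unique (solutionP nu N f) su; rewrite gt_eqF.
- by move=> nu N f u nu0 N1 bf su hN; exact: strict_maximum_principle hN.
- exists 31; split=> // nu N f u nu0 N1 bf su.
  exact: generalized_maximum_principle.
- exists 48^-1; split=> [|nu N nu0 N1]; first by rewrite invr_gt0.
  have H0 : 0 < \sum_(i < N) (i.+1%:R : R)^-1.
    apply: lt_le_trans (harmonic_ge R N); rewrite ln_gt0// ltr1n ltnS//.
  have l0 : 0 < resolvent nu N * \sum_(i < N) i.+1%:R^-1.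
    by rewrite mulr_gt0// resolvent_gt0.
  have [g [u [pg sg ng su lu]]] := extremal_of_test nu0
    (@trig_fejer_seq_periodic R N) (@trig_fejer_seq_bound R N) (ltr0n R 6) l0
    (fejer_seq_test nu N).
  exists g, u; split=> //; apply: le_trans lu; rewrite lee_fin.
  by have := @resolvent_log_lower R nu N N1; lra.
- exists 100^-1; split=> [|C C0]; first by rewrite invr_gt0.
  exact: small_viscosity_lower_bound.
Qed.
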